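(* Let $0<p<\infty$. There are positive real numbers $C_p^1$ and $C_p^2$, depending only on $p$, such that for all integers $n\ge2$ and $1\le m\le n$, $$\sigma_{m-1}^{p,\infty}(\theta_{p,p/n-1})\ge C_p^1\cdot\frac{\Gamma(n+1)}{\Gamma(n-m+1)}\cdot\frac{\Gamma(n/p+n-m+1)}{\Gamma(n/p+n+1)}$$ and $$\sigma_{m-1}^{p,\infty}(\theta_{p,p/n-1})\le C_p^2\cdot\frac{\Gamma(n+1)}{\Gamma(n-m+1)}\left\{\frac{\Gamma(n/p+n-m+1)}{\Gamma(n/p+n+1)}+\frac{1}{m!}\left(\frac{e^{-1}}{\Gamma(1/n)}\right)^m\right\}.$$ Furthermore, there are positive real numbers $C_p^1$ and $C_p^2$ (possibly different from those above), depending only on $p$, such that for every fixed integer $m\ge1$, $$\frac{C_p^1}{\left(\frac1p+1\right)^m}\le\liminf_{n\to\infty}\sigma_{m-1}^{p,\infty}(\theta_{p,p/n-1})\le\limsup_{n\to\infty}\sigma_{m-1}^{p,\infty}(\theta_{p,p/n-1})\le\frac{C_p^2}{\left(\frac1p+1\right)^m}.$$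
   Context: Let $\mathbb{R}_+=[0,\infty)$ and $\Delta_p^n=\{t\in\mathbb{R}_+^n:\sum_{j=1}^n t_j^p=1\}$. With $I\cdot A=\{tx:t\in I,x\in A\}$ and $\lambda$ the Lebesgue measure on $\mathbb{R}^n$, the normalized cone measure on $\Delta_p^n$ is $\mu_p(\mathcal{A})=\lambda([0,1]\cdot\mathcal{A})/\lambda([0,1]\cdot\Delta_p^n)$, $\mathcal{A}\subset\Delta_p^n$. For $\beta>-1$, $\theta_{p,\beta}$ is the probability measure on $\Delta_p^n$ that is absolutely continuous with respect to $\mu_p$ with density $$\frac{d\theta_{p,\beta}}{d\mu_p}(x)=c_{p,\beta}^{-1}\prod_{i=1}^n x_i^\beta,\qquad c_{p,\beta}=\int_{\Delta_p^n}\prod_{i=1}^n x_i^\beta\,d\mu_p(x);$$ $\theta_{p,p/n-1}$ is this measure on $\Delta_p^n$ with $\beta=p/n-1$ (the parameter $\beta$ depends on the dimension $n$). The best $m$-term approximation error is $\sigma_m(x)_q=\inf\{\|x-y\|_q:y\in\mathbb{R}^n\text{ has at most }m\text{ nonzero coordinates}\}$, with $\|\cdot\|_\infty$ the maximum norm for $q=\infty$, and for a Borel probability measure $\mu$ on $\Delta_p^n$ one sets $\sigma_m^{p,q}(\mu)=\int_{\Delta_p^n}\sigma_m(x)_q\,d\mu(x)$. $\Gamma$ is the Gamma function. *)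

(* Defs.v *)
From HB Require Import structures.
From mathcomp Require Import all_boot all_order all_algebra.
From mathcomp Require Import all_classical all_reals all_analysis.
Import Order.TTheory GRing.Theory Num.Theory.
Import numFieldNormedType.Exports.
Local Open Scope classical_set_scope.
Local Open Scope ring_scope.

(* R^n; tuples carry the product of the Borel sigma-algebras of R. *)
Notation Rn R n := (n.-tuple (measurableTypeR R)).

(* Lebesgue measure on R^(n+1) from the one on R^n: the image of the product
   measure under the identification of R x R^n with R^(n+1). *)
Section lebesgue_step.
Context (R : realType) (n : nat).
Variable mu : {sigma_finite_measure set (Rn R n) -> \bar R}.

Definition cons_Rn (x : measurableTypeR R * Rn R n) : Rn R n.+1 :=
  [tuple of x.1 :: x.2].

Lemma measurable_cons_Rn : measurable_fun [set: _] cons_Rn.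
Proof. exact: measurable_cons measurable_fst measurable_snd. Qed.

Definition lebesgue_step : set (Rn R n.+1) -> \bar R :=
  pushforward (lebesgue_measure \x mu)%E cons_Rn.

Let measurable_preimage_cons (A : set (Rn R n.+1)) :
  measurable A -> measurable (cons_Rn @^-1` A).
Proof.
by move=> mA; rewrite -[X in measurable X]setTI; exact: measurable_cons_Rn.
Qed.

Let step0 : lebesgue_step set0 = 0%E.
Proof. by rewrite /lebesgue_step /pushforward preimage_set0 measure0. Qed.

Let step_ge0 A : (0 <= lebesgue_step A)%E.
Proof. exact: (@measure_ge0 _ _ _ (lebesgue_measure \x mu)%E). Qed.

Let step_sigma_additive : semi_sigma_additive lebesgue_step.
Proof.
move=> F mF tF mUF; rewrite /lebesgue_step /pushforward preimage_bigcup.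
apply: (@measure_semi_sigma_additive _ _ _ (lebesgue_measure \x mu)%E).
- by move=> k; exact: measurable_preimage_cons.
- apply/trivIsetP => i j _ _ ij; rewrite -preimage_setI.
  by move/trivIsetP : tF => /(_ _ _ _ _ ij) ->//; rewrite preimage_set0.
- by rewrite -preimage_bigcup; exact: measurable_preimage_cons.
Qed.

HB.instance Definition _ := isMeasure.Build _ _ _ lebesgue_step
  step0 step_ge0 step_sigma_additive.

Lemma lebesgue_step_cylinder (A : set (measurableTypeR R)) (B : set (Rn R n)) :
  measurable A -> measurable B ->
  lebesgue_step [set x | A (thead x) /\ B [tuple of behead x]] =
  (lebesgue_measure A * mu B)%E.
Proof.
move=> mA mB; rewrite -product_measure1E// /lebesgue_step /pushforward.
congr ((_ \x _)%E _); apply/funext => -[x y] /=; rewrite theadE.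
by have -> : [tuple of behead (x :: y)] = y :> Rn R n by exact/val_inj.
Qed.

Let step_sigma_finite : sigma_finite setT lebesgue_step.
Proof.
have /sigma_finiteP[F [FT ndF Foo]] : sigma_finite setT
  (lebesgue_measure : {sigma_finite_measure set (measurableTypeR R) -> \bar R}).
  exact: sigma_finiteT.
have /sigma_finiteP[G [GT ndG Goo]] := sigma_finiteT mu.
exists (fun k => [set x | F k (thead x) /\ G k [tuple of behead x]]).
  apply/esym/seteqP; split=> // x _.
  have [i _ Fi] : (\bigcup_i F i) (thead x) by rewrite -FT.
  have [j _ Gj] : (\bigcup_i G i) [tuple of behead x] by rewrite -GT.
  exists (maxn i j) => //; split.
    by move: Fi; exact/subsetPset/ndF/leq_maxl.
  by move: Gj; exact/subsetPset/ndG/leq_maxr.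
move=> k; have [mF Fk] := Foo k; have [mG Gk] := Goo k; split.
  rewrite -[X in measurable X]setTI; apply: measurableI => //.
  rewrite (_ : [set _ | _] = (@thead _ _) @^-1` F k `&`
    (fun x : Rn R n.+1 => [tuple of behead x]) @^-1` G k)//.
  apply: measurableI; rewrite -[X in measurable X]setTI.
    exact: (@measurable_tnth _ (measurableTypeR R)).
  exact: measurable_behead.
by rewrite lebesgue_step_cylinder// lte_mul_pinfty// ge0_fin_numE.
Qed.

HB.instance Definition _ := @Measure_isSigmaFinite.Build _ _ _ lebesgue_step
  step_sigma_finite.

End lebesgue_step.

Fixpoint lebesgue_Rn {R : realType} (n : nat) :
    {sigma_finite_measure set (Rn R n) -> \bar R} :=
  if n is n'.+1 then lebesgue_step R n' (lebesgue_Rn n') else \d_[tuple].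

Definition simplex {R : realType} (p : R) (n : nat) : set (Rn R n) :=
  [set t | (forall j, 0 <= tnth t j) /\ \sum_(j < n) tnth t j `^ p = 1].

(* [0, 1] . A *)
Definition unit_cone {R : realType} {n : nat} (A : set (Rn R n)) :
    set (Rn R n) :=
  [set [tuple t * tnth x i | i < n] | t in `[0, 1] & x in A].

(* Measures on the simplex are set functions on R^n that only see the part of
   their argument lying in the simplex. *)
Definition cone_measure {R : realType} (p : R) (n : nat) (A : set (Rn R n)) :
    \bar R :=
  (lebesgue_Rn n (unit_cone (A `&` simplex p n)) /
   lebesgue_Rn n (unit_cone (simplex p n)))%E.

(* [0 `^ b] is 0 when b != 0, so for b < 0 the product vanishes, instead of
   being infinite, on the cone-null set of points with a zero coordinate. *)
Definition prod_powR {R : realType} (b : R) {n : nat} (x : Rn R n) : R :=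
  \prod_(i < n) tnth x i `^ b.

Definition theta_norm {R : realType} (p b : R) (n : nat) : \bar R :=
  (\int[cone_measure p n]_(x in simplex p n) (prod_powR b x)%:E)%E.

Definition theta {R : realType} (p b : R) (n : nat) (A : set (Rn R n)) :
    \bar R :=
  (\int[cone_measure p n]_(x in A `&` simplex p n)
     ((theta_norm p b n)^-1 * (prod_powR b x)%:E))%E.

(* Intended for 0 < q <= +oo; the value at q = -oo is a dummy. *)
Definition lq_norm {R : realType} (q : \bar R) {n : nat} (x : Rn R n) : R :=
  match q with
  | r%:E => (\sum_(i < n) `|tnth x i| `^ r) `^ r^-1
  | +oo%E => \big[Num.max/0]_(i < n) `|tnth x i|
  | -oo%E => 0
  end.

Definition best_approx {R : realType} (q : \bar R) (m : nat) {n : nat}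
    (x : Rn R n) : R :=
  inf [set lq_norm q [tuple tnth x i - tnth y i | i < n] |
        y in [set y : Rn R n | (#|[pred i | tnth y i != 0%R :> R]| <= m)%N]].

Definition avg_best_approx {R : realType} (p : R) (q : \bar R) (m : nat)
    {n : nat} (mu : set (Rn R n) -> \bar R) : \bar R :=
  (\int[mu]_(x in simplex p n) (best_approx q m x)%:E)%E.

(* Euler's integral; meaningful for z > 0. *)
Definition Gamma {R : realType} (z : R) : R :=
  \int[lebesgue_measure]_(t in `]0, +oo[) (t `^ (z - 1) * expR (- t)).

(* Main.v *)
(* Multiplying Lebesgue measure on the orthant by exp(- sum_i x_i^p) makes the
   coordinates independent, and integrating in polar coordinates relates this
   to the cone measure.  For beta = p/n - 1 the powers x_i^p become independent
   Gamma(1/n) variables, whose sum is exponential, so that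
     sigma_(m-1)(theta) = Gamma(1)/Gamma(1 + 1/p) * E[g_(m)]
   where g_(m) is the m-th largest of n independent variables with distribution
   function F(t) = P(Gamma(1/n) <= t^p).  For t <= 1, F(t)^n lies between
   constant multiples of t^p, so up to constants g_(m) is there the (n/p)-th
   power of the m-th largest of n uniform variables, whose mean is the quotient
   of Gamma values in the statement.  For t > 1, 1 - F(t) <= exp(- t^p)/Gamma(1/n)
   and a union bound over m-subsets gives the second term of the upper bound. *)
Require Import Defs.
From HB Require Import structures.
From mathcomp Require Import all_boot all_order all_algebra.
From mathcomp Require Import all_classical all_reals all_analysis.
From mathcomp Require Import measurable_realfun ring.
Import Order.TTheory GRing.Theory Num.Theory.
Import numFieldNormedType.Exports.
Local Open Scope classical_set_scope.
Local Open Scope ring_scope.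

(** * Integrals against set functions, iterated integrals *)

(** The cone measure and theta are mere set functions, so integrals against them are identified
    through their values on measurable sets, as images of weighted Lebesgue measure under the radial
    projection. No n-dimensional Jacobian occurs: volumes become iterated integrals over open
    half-lines, and polar coordinates become an exchange of integrals with a scaling of each
    coordinate. Nothing is ever sorted. Order statistics enter through the number of coordinates
    above a level t, so the mean is the integral over t of a polynomial in F(t) that decreases in
    F(t), and bounds on F carry over at once. The constants are free of n because Gamma(1/n)/n
    equals 1 up to a factor 1 + 1/n. On [0, 1] this keeps F(t) within a factor exp(2/n) of t^(p/n),
    and exp(2/n) is the (p/n)-th power of exp(2/p): the loss is a fixed rescaling of t. For fixed m
    the union-bound term is at most 1/m!, hence at most e^q / q^m for every q > 0; q = 1/p + 1 gives
    the rate of the main term. *)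

Section eq_setfun.
Import HBNNSimple.

(* The integral is defined against an arbitrary set function; since it depends
   only on the measurable sets, cone_measure and theta can be integrated against
   without being measures on all sets. *)
Lemma eq_setfun_integral d (T : measurableType d) (R : realType)
    (nu nu' : set T -> \bar R) (D : set T) (f : T -> \bar R) :
  (forall A, measurable A -> nu A = nu' A) ->
  (\int[nu]_(x in D) f x = \int[nu']_(x in D) f x)%E.
Proof.
move=> nunu'.
have H (g : T -> \bar R) :
    [set sintegral nu h | h in [set h : {nnsfun T >-> R} | forall x, ((h x)%:E <= g x)%E]] =
    [set sintegral nu' h | h in [set h : {nnsfun T >-> R} | forall x, ((h x)%:E <= g x)%E]].
  apply: eq_imagel => h _; rewrite /sintegral.
  by apply: eq_fsbigr => x _; rewrite nunu'.
by rewrite /integral !H.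
Qed.

End eq_setfun.

Section transfer.
Context d d' (X : measurableType d) (Y : measurableType d') (R : realType).
Variables (mu : {measure set X -> \bar R}) (phi : X -> Y) (g : X -> R).
Hypotheses (mphi : measurable_fun [set: X] phi) (mg : measurable_fun [set: X] g).
Hypothesis (g0 : forall x, 0 <= g x).
Local Open Scope ereal_scope.

Let nu (A : set Y) : \bar R := \int[mu]_x (g x * \1_A (phi x))%:E.

Let m1 (A : set Y) : measurable A ->
  measurable_fun [set: X] (fun x => (\1_A (phi x) : R)).
Proof. by move=> mA; apply: measurableT_comp => //; exact: measurable_indic. Qed.

Let nu0 : nu set0 = 0.
Proof. by apply: integral0_eq => x _; rewrite indic0 mulr0. Qed.

Let nu_ge0 A : 0 <= nu A.
Proof. by apply: integral_ge0 => x _; rewrite lee_fin mulr_ge0. Qed.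

Let nu_additive : semi_sigma_additive nu.
Proof.
move=> F mF tF mUF.
rewrite (_ : nu (\bigcup_n F n) = \sum_(n <oo) nu (F n)).
  by apply: is_cvg_ereal_nneg_natsum => n _; exact: nu_ge0.
rewrite /nu -integral_nneseries//; last 2 first.
  - by move=> n; apply/measurable_EFinP; apply: measurable_funM => //; exact: m1.
  - by move=> n x _; rewrite lee_fin mulr_ge0.
apply: eq_integral => x _.
under eq_eseriesr do rewrite EFinM.
rewrite nneseriesZl; last by move=> n _; rewrite lee_fin.
by rewrite EFinM indic_bigcup.
Qed.

HB.instance Definition _ := isMeasure.Build _ _ _ nu nu0 nu_ge0 nu_additive.

Import HBNNSimple.

Let transferT (f : Y -> \bar R) : measurable_fun [set: Y] f ->
  (forall y, 0 <= f y) ->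
  \int[nu]_y f y = \int[mu]_x ((g x)%:E * f (phi x)).
Proof.
move=> mf f0.
pose f_ := nnsfun_approx measurableT mf.
have cvf y : EFin \o f_ ^~ y @ \oo --> f y.
  by apply: cvg_nnsfun_approx => // z _; exact: f0.
transitivity (limn (fun n => \int[nu]_y (f_ n y)%:E)).
  rewrite -monotone_convergence//.
  - by apply: eq_integral => y _; apply/esym/cvg_lim => //; exact: cvf.
  - by move=> n; exact/measurable_EFinP/measurable_funP.
  - by move=> n y _; rewrite lee_fin.
  - by move=> y _ m n mn; rewrite lee_fin; exact/lefP/nd_nnsfun_approx.
transitivity (limn (fun n => \int[mu]_x (g x * f_ n (phi x))%:E)); last first.
  rewrite -monotone_convergence//.
  - apply: eq_integral => x _; apply/cvg_lim => //.
    under eq_fun do rewrite EFinM.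
    by apply: cvgeZl => //; exact: cvf.
  - move=> n; apply/measurable_EFinP; apply: measurable_funM => //.
    by apply: measurableT_comp.
  - by move=> n x _; rewrite lee_fin mulr_ge0.
  - move=> x _ m n mn; rewrite lee_fin ler_wpM2l//.
    exact/lefP/nd_nnsfun_approx.
congr (limn _); apply/funext => n.
under [LHS]eq_integral do rewrite fimfunE -fsumEFin//.
rewrite ge0_integral_fsum//; last 2 first.
  - move=> r; apply/measurable_EFinP; exact: measurable_funM.
  - by move=> r y _; rewrite EFinM nnfun_muleindic_ge0.
transitivity (\int[mu]_x (\sum_(r \in range (f_ n))
    (g x * (r * \1_(f_ n @^-1` [set r]) (phi x)))%:E)); last first.
  by apply: eq_integral => x _; rewrite fsumEFin// -mulr_fsumr// -fimfunE.
rewrite ge0_integral_fsum//; last 2 first.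
  - move=> r; apply/measurable_EFinP; apply: measurable_funM => //.
    by apply: measurable_funM => //; exact: m1.
  - move=> r x _; rewrite EFinM mule_ge0 ?lee_fin//.
    exact: nnfun_muleindic_ge0.
apply: eq_fsbigr => r _.
rewrite integralZl_indic_nnsfun//.
rewrite integral_indic// setIT.
transitivity (\int[mu]_x (r%:E * (g x * \1_(f_ n @^-1` [set r]) (phi x))%:E)); last first.
  by apply: eq_integral => x _; rewrite -EFinM mulrCA.
have [r0|r0] := leP 0%R r.
  rewrite ge0_integralZl//.
  - by apply/measurable_EFinP; apply: measurable_funM => //; exact: m1.
  - by move=> x _; rewrite lee_fin mulr_ge0.
rewrite preimage_nnfun0//.
rewrite measure0 mule0 integral0_eq// => x _.
by rewrite indic0 mulr0 mule0.
Qed.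

(** Covers both the radial projection and the one-dimensional substitutions: [nu'] is the image
    under [phi] of the measure with density [g], and agreement on measurable sets is enough. *)
Lemma ge0_integral_transfer (nu' : set Y -> \bar R) (f : Y -> \bar R) :
  (forall A, measurable A -> nu' A = \int[mu]_x (g x * \1_A (phi x))%:E) ->
  measurable_fun [set: Y] f -> (forall y, 0 <= f y) ->
  \int[nu']_y f y = \int[mu]_x ((g x)%:E * f (phi x)).
Proof.
by move=> nu'E mf f0; rewrite (@eq_setfun_integral _ _ _ nu' nu) ?transferT.
Qed.

(** Packaged as a measure, the image can be fed to the uniqueness theorem for measures agreeing on a
    generating pi-system. *)
Lemma transfer_measure : exists M : {measure set Y -> \bar R},
  forall A, M A = \int[mu]_x (g x * \1_A (phi x))%:E.
Proof. by exists nu. Qed.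

End transfer.

Lemma tonelli_on d1 d2 (T1 : measurableType d1) (T2 : measurableType d2)
    (R : realType) (m1 : {sigma_finite_measure set T1 -> \bar R})
    (m2 : {sigma_finite_measure set T2 -> \bar R}) (D1 : set T1) (D2 : set T2)
    (f : T1 * T2 -> \bar R) :
  measurable D1 -> measurable D2 ->
  measurable_fun [set: T1 * T2] f -> (forall x, 0 <= f x)%E ->
  (\int[m1]_(x in D1) \int[m2]_(y in D2) f (x, y) =
   \int[m2]_(y in D2) \int[m1]_(x in D1) f (x, y))%E.
Proof.
move=> mD1 mD2 mf f0.
pose h := (f \_ (D1 `*` D2)).
have mh : measurable_fun [set: T1 * T2] h.
  apply/(measurable_restrictT f) => //; first exact: measurableX.
  exact: measurable_funTS.
have h0 z : (0 <= h z)%E by rewrite /h patchE; case: ifP.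
transitivity (\int[m1]_x \int[m2]_y h (x, y))%E.
  rewrite integral_mkcond; apply: eq_integral => x _.
  rewrite patchE; case: ifPn => xD1.
    rewrite integral_mkcond; apply: eq_integral => y _; rewrite /h !patchE.
    by rewrite in_setX /= xD1.
  by rewrite integral0_eq// => y _; rewrite /h patchE in_setX/= (negbTE xD1).
rewrite fubini_tonelli//.
rewrite [RHS]integral_mkcond; apply: eq_integral => y _.
rewrite patchE; case: ifPn => yD2.
  rewrite [RHS]integral_mkcond; apply: eq_integral => x _; rewrite /h !patchE.
  by rewrite in_setX /= yD2 andbT.
by rewrite integral0_eq// => x _; rewrite /h patchE in_setX/= (negbTE yD2) andbF.
Qed.

Lemma measurable_fun_integral_on d1 d2 (T1 : measurableType d1)
    (T2 : measurableType d2) (R : realType)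
    (m2 : {sigma_finite_measure set T2 -> \bar R}) (D2 : set T2)
    (f : T1 * T2 -> \bar R) :
  measurable D2 -> measurable_fun [set: T1 * T2] f -> (forall x, 0 <= f x)%E ->
  measurable_fun [set: T1] (fun x => \int[m2]_(y in D2) f (x, y))%E.
Proof.
move=> mD2 mf f0.
pose h := (f \_ ([set: T1] `*` D2)).
have mh : measurable_fun [set: T1 * T2] h.
  apply/(measurable_restrictT f) => //; first exact: measurableX.
  exact: measurable_funTS.
have h0 z : (0 <= h z)%E by rewrite /h patchE; case: ifP.
rewrite [X in measurable_fun _ X](_ : _ = fubini_F m2 h).
  exact: measurable_fun_fubini_tonelli_F.
apply/funext => x; rewrite integral_mkcond; apply: eq_integral => y _.
by rewrite /h !patchE in_setX/= in_setT.
Qed.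

Section iterated.
Context {R : realType}.
Local Notation mu := (@lebesgue_measure R).
Local Open Scope ereal_scope.

(** The half-lines are open, so integrands matter only where all coordinates are positive; there the
    norm is positive and negative powers take their true values. *)
Fixpoint iter_int (n : nat) : (Rn R n -> \bar R) -> \bar R :=
  if n is n'.+1
  then fun f => \int[mu]_(x in `]0%R, +oo[) iter_int n' (fun y => f (cons_Rn R n' (x, y)))
  else fun f => f [tuple].

Lemma iter_int_ge0 n (f : Rn R n -> \bar R) :
  (forall x, 0 <= f x) -> 0 <= iter_int n f.
Proof.
elim: n f => [|n IH] f f0 //=.
by apply: integral_ge0 => x _; apply: IH.
Qed.

Lemma eq_iter_int n (f g : Rn R n -> \bar R) :
  (forall x, (forall i, 0 < tnth x i)%R -> f x = g x) ->
  iter_int n f = iter_int n g.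
Proof.
elim: n f g => [|n IH] f g fg /=; first by apply: fg => -[].
apply: eq_integral => x; rewrite inE/= in_itv/= andbT => x0.
apply: IH => y y0; apply: fg => i.
rewrite /cons_Rn; case: (unliftP ord0 i) => [j|] ->; last by rewrite tnth0.
by rewrite tnthS.
Qed.

(** The parameter space [X] is arbitrary because the induction moves the first coordinate into
    it. *)
Lemma measurable_fun_iter_int n d (X : measurableType d) (f : X * Rn R n -> \bar R) :
  measurable_fun [set: X * Rn R n] f -> (forall z, 0 <= f z) ->
  measurable_fun [set: X] (fun x => iter_int n (fun y => f (x, y))).
Proof.
elim: n d X f => [|n IH] d X f mf f0 /=.
  by apply: (measurableT_comp mf); exact: measurable_fun_pair.
pose f' (z : (X * measurableTypeR R) * Rn R n) := f (z.1.1, cons_Rn R n (z.1.2, z.2)).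
have mf' : measurable_fun [set: _] f'.
  apply: (measurableT_comp mf); apply: measurable_fun_pair => //=.
    exact: measurableT_comp.
  apply: (measurableT_comp (measurable_cons_Rn _ _)).
  apply: measurable_fun_pair => //=.
  exact: measurableT_comp.
have f'0 z : 0 <= f' z by exact: f0.
apply: (measurable_fun_integral_on _ _ _ _ _ _ _ (fun z : X * measurableTypeR R =>
   iter_int n (fun y => f' (z, y)))) => //; first exact: IH.
by move=> z /=; apply: iter_int_ge0 => y; exact: f'0.
Qed.

Lemma iter_int_swap n d (X : measurableType d)
    (m : {sigma_finite_measure set X -> \bar R}) (D : set X)
    (f : X * Rn R n -> \bar R) :
  measurable D -> measurable_fun [set: X * Rn R n] f -> (forall z, 0 <= f z) ->
  \int[m]_(x in D) iter_int n (fun y => f (x, y)) =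
  iter_int n (fun y => \int[m]_(x in D) f (x, y)).
Proof.
elim: n f => [|n IH] f mD mf f0 //=.
pose f' (z : (X * measurableTypeR R) * Rn R n) := f (z.1.1, cons_Rn R n (z.1.2, z.2)).
have mf' : measurable_fun [set: _] f'.
  apply: (measurableT_comp mf); apply: measurable_fun_pair => //=.
    exact: measurableT_comp.
  apply: (measurableT_comp (measurable_cons_Rn _ _)).
  apply: measurable_fun_pair => //=.
  exact: measurableT_comp.
rewrite (tonelli_on _ _ _ _ _ m mu _ _ (fun z : X * measurableTypeR R =>
   iter_int n (fun y => f' (z, y))))//.
- apply: eq_integral => t _.
  rewrite -(IH (fun z : X * Rn R n => f (z.1, cons_Rn R n (t, z.2))))//.
  apply: (measurableT_comp mf); apply: measurable_fun_pair => //=.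
  apply: (measurableT_comp (measurable_cons_Rn _ _)).
  by apply: measurable_fun_pair => //=.
- by apply: (measurable_fun_iter_int n _ _ f') => // z; exact: f0.
- by move=> z /=; apply: iter_int_ge0 => y; exact: f0.
Qed.

Lemma iter_intZl n (k : \bar R) (f : Rn R n -> \bar R) :
  measurable_fun [set: Rn R n] f -> (forall z, 0 <= f z) -> 0 <= k ->
  iter_int n (fun x => k * f x) = k * iter_int n f.
Proof.
move=> + + k0; elim: n f => [|n IH] f mf f0 //=.
rewrite -ge0_integralZl//.
- apply: eq_integral => x _; rewrite IH//.
  apply: (measurableT_comp mf).
  apply: (measurableT_comp (measurable_cons_Rn _ _)).
  by apply: measurable_fun_pair => //=.
- apply: measurable_funTS.
  apply: (measurable_fun_iter_int n _ _ (fun z => f (cons_Rn R n z))) => //.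
  apply: (measurableT_comp mf).
  exact: measurable_cons_Rn.
- by move=> x _; apply: iter_int_ge0.
Qed.

Definition orthant n : set (Rn R n) := [set x | forall i, (0 <= tnth x i)%R].

Lemma measurable_orthant n : measurable (orthant n).
Proof.
rewrite (_ : orthant n = \bigcap_(i in [set: 'I_n])
  ((@tnth n (measurableTypeR R))^~ i @^-1` `[0%R, +oo[)).
  apply: fin_bigcap_measurable => // i _.
  rewrite -[X in measurable X]setTI.
  by apply: measurable_tnth.
apply/seteqP; split=> x /= H i; first by move=> _ /=; rewrite in_itv/= H.
by have := H i Logic.I; rewrite /= in_itv/= andbT.
Qed.

Lemma integral_orthant n (f : Rn R n -> \bar R) :
  measurable_fun [set: Rn R n] f -> (forall z, 0 <= f z) ->
  \int[lebesgue_Rn n]_(x in orthant n) f x = iter_int n f.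
Proof.
elim: n f => [|n IH] f mf f0.
  change (\int[\d_ ([tuple] : Rn R 0)]_(x in orthant 0) f x = iter_int 0 f).
  rewrite integral_dirac//; last 2 first.
  - exact: measurable_orthant.
  - exact: measurable_funTS.
  by rewrite diracE mem_set ?mul1e// => -[].
have mc : measurable_fun [set: _] (fun z => f (cons_Rn R n z)).
  apply: (measurableT_comp mf); exact: measurable_cons_Rn.
change (\int[pushforward (mu \x @lebesgue_Rn R n) (cons_Rn R n)]_(x in orthant n.+1) f x = iter_int n.+1 f).
rewrite ge0_integral_pushforward//; last 3 first.
- exact: measurable_cons_Rn.
- exact: measurable_orthant.
- exact: measurable_funTS.
rewrite (_ : _ @^-1` _ = `[0%R, +oo[ `*` orthant n); last first.
  apply/seteqP; split => [[x y] /= H|[x y] /= [x0 y0] i].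
    split=> [|i]; first by rewrite /= in_itv/= andbT; have := H ord0; rewrite tnth0.
    by have := H (lift ord0 i); rewrite tnthS.
  rewrite /cons_Rn; case: (unliftP ord0 i) => [j|] ->; rewrite ?tnth0 ?tnthS//=.
  by move: x0; rewrite in_itv/= andbT.
rewrite integral_mkcond fubini_tonelli1//=; last 2 first.
- apply/(measurable_restrictT (fun z => f (cons_Rn R n z))).
    by apply: measurableX => //; exact: measurable_orthant.
  exact: measurable_funTS.
- by move=> z; apply: erestrict_ge0 => *; exact: f0.
(* The closed orthant and the open half-lines differ by the endpoint 0, a null set. *)
rewrite integral_itv_obnd_cbnd; last first.
  apply: measurable_funTS.
  by apply: (measurable_fun_iter_int n _ _ (fun z => f (cons_Rn R n z))).
rewrite [RHS]integral_mkcond.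
apply: eq_integral => x _; rewrite /fubini_F patchE; case: ifPn => x0.
  rewrite -IH//; last first.
    by apply: (measurableT_comp mc); exact: measurable_fun_pair.
  rewrite [RHS]integral_mkcond; apply: eq_integral => y _.
  by rewrite !patchE in_setX /= x0.
by apply: integral0_eq => y _; rewrite patchE in_setX/= (negbTE x0).
Qed.

End iterated.

(** * Substitutions on the half-line *)

Section change_of_variables.
Context {R : realType}.
Local Notation mu := (@lebesgue_measure R).
Local Open Scope ereal_scope.

Lemma integral_indicM d (T : measurableType d) (m : {measure set T -> \bar R})
    (D : set T) (f : T -> \bar R) :
  \int[m]_(x in D) f x = \int[m]_x ((\1_D x)%:E * f x).
Proof.
rewrite integral_mkcond; apply: eq_integral => x _.
by rewrite patchE indicE; case: (x \in D); rewrite ?mul1e ?mul0e.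
Qed.

Lemma lebesgue_itv0 (b : R) : (0 < b)%R -> mu `]0%R, b[%classic = b%:E.
Proof. by move=> b0; rewrite lebesgue_measure_itv/= lte_fin b0 sube0. Qed.

(** The hypothesis compares the image under [phi] of the density [phi'] with Lebesgue measure on
    half-lines only: [Num.max b 0] is the length of (0, b). Half-lines generate the Borel sets and
    are stable under intersection, so the two measures coincide. *)
Lemma ge0_change_of_variables (phi phi' : R -> R) (f : R -> \bar R) :
  measurable_fun [set: R] phi -> measurable_fun [set: R] phi' ->
  (forall u, 0 <= phi' u)%R ->
  (forall b, \int[mu]_(u in `]0%R, +oo[) (phi' u * \1_(`]-oo, b[%classic) (phi u))%:E =
             (Num.max b 0)%:E) ->
  measurable_fun [set: R] f -> (forall x, 0 <= f x) ->
  \int[mu]_(u in `]0%R, +oo[) ((phi' u)%:E * f (phi u)) =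
  \int[mu]_(x in `]0%R, +oo[) f x.
Proof.
move=> mphi mphi' phi'0 H mf f0.
pose D : set R := `]0%R, +oo[%classic.
have mD : measurable D by exact: measurable_itv.
have mi : measurable_fun [set: R] (\1_D : R -> R) by exact: measurable_indic.
have [M ME] : exists M : {measure set (measurableTypeR R) -> \bar R},
    forall A, M A = \int[mu]_u (\1_D u * phi' u * \1_A (phi u))%:E.
  apply: transfer_measure => //; first exact: measurable_funM.
  by move=> u; rewrite mulr_ge0.
have [N NE] : exists N : {measure set (measurableTypeR R) -> \bar R},
    forall A, N A = \int[mu]_u (\1_D u * \1_A u)%:E.
  by apply: (transfer_measure _ _ _ _ _ mu (fun u => u)) => //.
have MN A : measurable A -> M A = N A.
  apply: (@measure_unique _ R (measurableTypeR R) (@RGenInftyO.G R)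
    (fun k : nat => `]-oo, (k%:R : R)[%classic) _ _ _ _ M N).
  - exact: RGenInftyO.measurableE.
  - move=> _ _ [x ->] [y ->]; exists (Num.min x y).
    by apply/seteqP; split=> z /=; rewrite !in_itv/= lt_min => /andP.
  - by move=> k; exists k%:R.
  - apply/seteqP; split=> // x _; exists (Num.truncn x).+1 => //=.
    by rewrite in_itv/= truncnS_gt.
  - move=> _ [b ->]; rewrite ME NE.
    transitivity (\int[mu]_(u in `]0%R, +oo[) (phi' u * \1_(`]-oo, b[%classic) (phi u))%:E).
      rewrite [RHS]integral_indicM; apply: eq_integral => u _.
      by rewrite -EFinM mulrA.
    rewrite H.
    transitivity (\int[mu]_(u in D) (\1_(`]-oo, b[%classic) u)%:E); last first.
      rewrite integral_indicM; apply: eq_integral => u _.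
      by rewrite -EFinM.
    rewrite integral_indic//.
    have [b0|b0] := leP b 0%R.
      rewrite (_ : _ `&` _ = set0) ?measure0//.
      apply/seteqP; split=> // x [] /=; rewrite /D /= !in_itv/= ?andbT => xb x0.
      by have := lt_trans x0 (lt_le_trans xb b0); rewrite ltxx.
    rewrite (_ : _ `&` _ = `]0%R, b[%classic); last first.
      by apply/seteqP; split=> x /=; rewrite /D /= !in_itv/= ?andbT; [case=> -> ->|move=> /andP[-> ->]].
    exact/esym/lebesgue_itv0.
  (* Uniqueness asks for finite mass on an exhausting sequence; the half-line ending at k has mass
     k. *)
  - move=> k; rewrite ME.
    suff -> : \int[mu]_x (\1_D x * phi' x * \1_(`]-oo, k%:R[%classic) (phi x))%:E =
      (Num.max k%:R 0)%:E :> \bar R by rewrite ltry.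
    rewrite -H [RHS]integral_indicM; apply: eq_integral => u _.
    by rewrite -EFinM mulrA.
transitivity (\int[M]_x f x).
  transitivity (\int[mu]_u ((\1_D u * phi' u)%:E * f (phi u))).
    by rewrite integral_indicM; apply: eq_integral => u _; rewrite EFinM muleA.
  symmetry.
  pose psi : measurableTypeR R -> measurableTypeR R := phi.
  have mpsi : measurable_fun [set: _] psi by [].
  have mf' : measurable_fun [set: measurableTypeR R] f by [].
  apply: (ge0_integral_transfer _ _ _ _ _ mu psi (fun u => \1_D u * phi' u)%R mpsi) => //.
    exact: measurable_funM.
  by move=> u; rewrite mulr_ge0.
rewrite (eq_setfun_integral _ _ _ _ _ _ _ MN).
transitivity (\int[mu]_u ((\1_D u)%:E * f u)); last by rewrite [RHS]integral_indicM.
by apply: (ge0_integral_transfer _ _ _ _ _ mu (fun u => u) \1_D).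
Qed.

Lemma integral_scale (c : R) (f : R -> \bar R) : (0 < c)%R ->
  measurable_fun [set: R] f -> (forall x, 0 <= f x) ->
  \int[mu]_(u in `]0%R, +oo[) (c%:E * f (c * u)%R) =
  \int[mu]_(x in `]0%R, +oo[) f x.
Proof.
move=> c0 mf f0.
apply: (ge0_change_of_variables (fun u => c * u)%R (fun=> c)) => //.
- exact: mulrl_measurable.
- by move=> _; exact: ltW.
move=> b.
under eq_integral do rewrite EFinM.
rewrite ge0_integralZl//; last 2 first.
- apply/measurable_EFinP; apply: measurable_funTS.
  apply: measurableT_comp; last exact: mulrl_measurable.
  exact: measurable_indic.
- by rewrite lee_fin ltW.
under eq_integral => u _.
  rewrite (_ : \1_(`]-oo, b[%classic) (c * u)%R = \1_(`]-oo, (b / c)%R[%classic) u); last first.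
    by rewrite !indicE; congr ((nat_of_bool _)%:R); apply/idP/idP; rewrite !inE /= !in_itv/= ltr_pdivlMr// mulrC.
  over.
rewrite integral_indic//.
have [b0|b0] := leP b 0%R.
  rewrite (_ : _ `&` _ = set0) ?measure0 ?mule0//.
  apply/seteqP; split=> // x [] /=; rewrite !in_itv/= ?andbT => xb x0.
  have : (x < 0)%R by rewrite (lt_le_trans xb)// pmulr_lle0// invr_gt0.
  by move=> /(lt_trans x0); rewrite ltxx.
rewrite (_ : _ `&` _ = `]0%R, (b / c)%R[%classic); last first.
  by apply/seteqP; split=> x /=; rewrite !in_itv/= ?andbT; [case=> -> ->|move=> /andP[-> ->]].
transitivity (c%:E * (b / c)%:E).
  by congr (_ * _); apply: lebesgue_itv0; rewrite divr_gt0.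
by rewrite -EFinM mulrC divfK// gt_eqF.
Qed.

Lemma ge0_FTC_pos (F f : R -> R) (s t : R) : (0 < s)%R -> (s < t)%R ->
  (forall x : R, 0 < x -> is_derive x 1 F (f x))%R ->
  (forall x : R, 0 < x -> {for x, continuous f})%R ->
  \int[mu]_(x in `[s, t]) (f x)%:E = (F t - F s)%:E.
Proof.
move=> s0 st dF cf.
have cF x : (0 < x)%R -> {for x, continuous F}.
  move=> x0; apply: differentiable_continuous; apply/derivable1_diffP.
  by have [] := dF x x0.
rewrite (continuous_FTC2 (F := F))//.
- apply: continuous_in_subspaceT => x; rewrite inE/= in_itv/= => /andP[sx _].
  by apply: cf; rewrite (lt_le_trans s0).
- split.
  + move=> x; rewrite in_itv/= => /andP[sx _].
    by have [] := dF x (lt_trans s0 sx).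
  + by apply: cvg_at_right_filter; exact: cF.
  + by apply: cvg_at_left_filter; apply: cF; rewrite (lt_trans s0).
- move=> x; rewrite in_itv/= => /andP[sx _].
  by have [_] := dF x (lt_trans s0 sx); rewrite derive1E.
Qed.

Lemma continuous_powR_gt0 (a x : R) : (0 < x)%R ->
  {for x, continuous (fun y => y `^ a)%R}.
Proof.
move=> x0; apply: differentiable_continuous; apply/derivable1_diffP.
by apply: derivable_powR; rewrite in_itv/= x0.
Qed.

(** For [a < 1] the integrand is unbounded at 0, so the fundamental theorem is applied on [s_k, t]
    with s_k decreasing to 0, and the integrals increase to the one over (0, t]. *)
Lemma integral_powR (a t : R) : (0 < a)%R -> (0 <= t)%R ->
  \int[mu]_(x in `]0%R, t[) (a * x `^ (a - 1))%:E = (t `^ a)%:E.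
Proof.
move=> a0; rewrite le_eqVlt => /predU1P[<-|t0].
  by rewrite set_itv_ge ?bnd_simp ?ltxx// integral_set0 powR0// gt_eqF.
pose f x := (a * x `^ (a - 1))%R.
have mf : measurable_fun [set: R] f.
  by apply: measurable_funM => //; exact: measurable_powR.
have f0 x : (0 <= f x)%R by rewrite mulr_ge0 ?powR_ge0// ltW.
rewrite (@integral_itv_bndo_bndc _ (BRight 0%R)); last first.
  by apply: measurable_funTS; exact/measurable_EFinP.
(* The denominator [k.+2] makes s_k < t already for k = 0. *)
pose s (k : nat) := (t / k.+2%:R)%R.
have s0 k : (0 < s k)%R by rewrite divr_gt0.
have st k : (s k < t)%R.
  by rewrite ltr_pdivrMr// ltr_pMr// ltr1n.
have sd k l : (k <= l)%N -> (s l <= s k)%R.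
  by move=> kl; rewrite ler_pM2l// lef_pV2 ?posrE// ler_nat.
have cvs : s @ \oo --> 0%R.
  rewrite -[X in _ --> X](mulr0 t); apply: cvgMr.
  have := @cvg_harmonic R; rewrite -cvg_shiftS; exact.
have UE : \bigcup_k `[s k, t]%classic = `]0%R, t]%classic.
  apply/seteqP; split=> x /=.
    by move=> [k _] /=; rewrite !in_itv/= => /andP[sx ->]; rewrite (lt_le_trans (s0 k)).
  rewrite in_itv/= => /andP[x0 xt].
  have /cvgrPdist_lt/(_ _ x0)[k _ /(_ k (leqnn _)) /=] := cvs.
  rewrite sub0r normrN ger0_norm ?(ltW (s0 _))// => skx.
  by exists k => //=; rewrite in_itv/= xt ltW.
have H : \int[mu]_(x in `[s k, t]) (f x)%:E @[k --> \oo] --> \int[mu]_(x in `]0%R, t]) (f x)%:E.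
  rewrite -UE; apply: ge0_nondecreasing_set_cvg_integral => //.
  - move=> k l kl; rewrite subsetEset => x /=; rewrite !in_itv/= => /andP[sx ->].
    by rewrite (le_trans (sd _ _ kl)).
  - by move=> k; apply: measurable_funTS; exact/measurable_EFinP.
  - by move=> k x _; rewrite lee_fin.
have E k : \int[mu]_(x in `[s k, t]) (f x)%:E = (t `^ a - s k `^ a)%:E.
  apply: (ge0_FTC_pos (fun x => x `^ a)%R) => // x x0.
  by apply: continuousM; [exact: cvg_cst|exact: continuous_powR_gt0].
have H2 : \int[mu]_(x in `[s k, t]) (f x)%:E @[k --> \oo] --> (t `^ a)%:E.
  under eq_fun do rewrite E.
  apply: cvg_EFin; first by near=> k.
  rewrite -[X in _ --> X]subr0; apply: cvgB; first exact: cvg_cst.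
  have /cvg_at_rightP := @powR_cvg0 R a a0.
  by apply; split.
exact: cvg_unique _ H H2.
Unshelve. all: by end_near. Qed.

Lemma integral_powR_subst (a : R) (f : R -> \bar R) : (0 < a)%R ->
  measurable_fun [set: R] f -> (forall x, 0 <= f x) ->
  \int[mu]_(u in `]0%R, +oo[) ((a * u `^ (a - 1))%:E * f (u `^ a)%R) =
  \int[mu]_(x in `]0%R, +oo[) f x.
Proof.
move=> a0 mf f0.
apply: (ge0_change_of_variables (fun u => u `^ a)%R (fun u => a * u `^ (a - 1))%R) => //.
- by apply: measurable_funM => //; exact: measurable_powR.
- by move=> u; rewrite mulr_ge0 ?powR_ge0// ltW.
move=> b.
have [b0|b0] := leP b 0%R.
  rewrite integral0_eq// => u _.
  rewrite indicE memNset ?mulr0//= in_itv/=; apply/negP; rewrite -leNgt.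
  by rewrite (le_trans b0)// powR_ge0.
transitivity (\int[mu]_(u in `]0%R, (b `^ a^-1)%R[) (a * u `^ (a - 1))%:E); last first.
  by rewrite integral_powR ?powR_ge0// -powRrM mulVf ?gt_eqF// powRr1// ltW.
rewrite integral_mkcond [RHS]integral_mkcond; apply: eq_integral => u _.
rewrite !patchE; have [|] := boolP (u \in `]0%R, +oo[%classic).
  rewrite inE/= in_itv/= andbT => u0.
  have E : (u `^ a < b)%R = (u < b `^ a^-1)%R.
    have uE : ((u `^ a) `^ a^-1 = u)%R by rewrite -powRrM mulfV ?gt_eqF// powRr1// ltW.
    apply/idP/idP => ub.
      by rewrite -[ltLHS]uE gt0_ltr_powR ?invr_gt0// nnegrE ?powR_ge0// ltW.
    rewrite ltNge; apply/negP => bu.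
    suff : (b `^ a^-1 <= u)%R by rewrite leNgt ub.
    by rewrite -[leRHS]uE ge0_ler_powR// ?nnegrE ?powR_ge0// ?invr_ge0 ltW.
  rewrite indicE.
  have -> : ((u `^ a)%R \in `]-oo, b[%classic) = (u `^ a < b)%R.
    by apply/idP/idP; rewrite inE/= in_itv.
  have -> : (u \in `]0%R, (b `^ a^-1)%R[%classic) = (u < b `^ a^-1)%R.
    by apply/idP/idP; rewrite inE/= in_itv/= u0.
  by rewrite -E; case: ifP; rewrite ?mulr1 ?mulr0.
move=> /negP u0; rewrite memNset//= in_itv/= => /andP[u0' _].
by apply: u0; rewrite inE/= in_itv/= u0'.
Qed.

End change_of_variables.

Lemma measurable_fun_natr_bool d (T : measurableType d) (R : realType)
    (b : T -> bool) :
  measurable_fun [set: T] b -> measurable_fun [set: T] (fun x => (b x)%:R : R).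
Proof.
move=> mb; have mn : measurable_fun [set: bool] (fun c : bool => c%:R : R) by [].
exact: (measurableT_comp mn mb).
Qed.

Lemma measurable_fun_powR d (T : measurableType d) (R : realType) (f : T -> R) a :
  measurable_fun [set: T] f -> measurable_fun [set: T] (fun x => f x `^ a).
Proof. by move=> mf; apply: (@measurableT_comp _ _ _ _ _ _ (fun t => t `^ a)). Qed.

(** * Polar integration *)

Section power_tail.
Context {R : realType}.
Local Notation mu := (@lebesgue_measure R).
Local Open Scope ereal_scope.

Lemma ge0_FTC_posy (F f : R -> R) (s l : R) : (0 < s)%R ->
  (forall x : R, 0 < x -> is_derive x 1 F (f x))%R ->
  (forall x : R, 0 < x -> {for x, continuous f})%R ->
  (forall x, 0 <= f x)%R ->
  (F x @[x --> +oo%R] --> l)%R ->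
  \int[mu]_(x in `[s, +oo[) (f x)%:E = (l - F s)%:E.
Proof.
move=> s0 dF cf f0 Fl.
have cF x : (0 < x)%R -> {for x, continuous F}.
  move=> x0; apply: differentiable_continuous; apply/derivable1_diffP.
  by have [] := dF x x0.
rewrite (ge0_continuous_FTC2y (F := F) (l := l))//.
- apply: continuous_in_subspaceT => x; rewrite inE/= in_itv/= andbT => sx.
  by apply: cf; rewrite (lt_le_trans s0).
- by move=> x sx; have [] := dF x (lt_trans s0 sx).
- by apply: cvg_at_right_filter; exact: cF.
- move=> x; rewrite in_itv/= andbT => sx.
  by have [_] := dF x (lt_trans s0 sx); rewrite derive1E.
Qed.

Lemma cvg_powRN_pinfty (a : R) : (0 < a)%R ->
  (x `^ (- a) @[x --> +oo] --> (0 : R))%R.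
Proof.
move=> a0; apply/cvgrPdist_le => e e0; near=> x.
have x0 : (0 < x)%R by near: x; apply: nbhs_pinfty_gt; rewrite num_real.
have xe : (e `^ (- a^-1) <= x)%R by near: x; apply: nbhs_pinfty_ge; rewrite num_real.
rewrite sub0r normrN ger0_norm ?powR_ge0// powRN.
rewrite -[leRHS]invrK lef_pV2 ?posrE ?powR_gt0 ?invr_gt0//.
have -> : (e^-1 = (e `^ (- a^-1)) `^ a)%R.
  by rewrite -powRrM mulNr mulVf ?gt_eqF// powR_inv1// ltW.
by rewrite ge0_ler_powR ?nnegrE ?powR_ge0// ltW.
Unshelve. all: by end_near. Qed.

Lemma integral_powRN_tail (a s : R) : (0 < a)%R -> (0 < s)%R ->
  \int[mu]_(x in `[s, +oo[) (a * x `^ (- a - 1))%:E = (s `^ (- a))%:E.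
Proof.
move=> a0 s0.
transitivity ((0 - - s `^ (- a))%R%:E : \bar R); last by rewrite sub0r opprK.
apply: (ge0_FTC_posy (fun x => - x `^ (- a))%R) => //.
- move=> x x0.
  have -> : (a * x `^ (- a - 1) = - (- a * x `^ (- a - 1)))%R by rewrite mulNr opprK.
  by apply: is_deriveN; exact: is_derive1_powR.
- move=> x x0; apply: continuousM; [exact: cvg_cst|exact: continuous_powR_gt0].
- by move=> x; rewrite mulr_ge0 ?powR_ge0// ltW.
- rewrite -oppr0; apply: cvgN; exact: cvg_powRN_pinfty.
Qed.

Lemma integral_expRN_tail (s : R) : (0 < s)%R ->
  \int[mu]_(x in `[s, +oo[) (expR (- x))%:E = (expR (- s))%:E.
Proof.
move=> s0.
transitivity ((0 - - expR (- s))%R%:E : \bar R); last by rewrite sub0r opprK.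
apply: (ge0_FTC_posy (fun x => - expR (- x))%R) => //.
- move=> x x0.
  have -> : (expR (- x) = - (expR (- x) * -1))%R by rewrite mulrN1 opprK.
  apply: is_deriveN; apply: is_derive1_comp.
- move=> x x0; apply: continuous_comp; last exact: continuous_expR.
  by apply: continuousN.
- rewrite -oppr0; apply: cvgN; exact: cvgr_expR.
Qed.

End power_tail.

Section polar.
Context {R : realType}.
Local Notation mu := (@lebesgue_measure R).
Local Open Scope ereal_scope.

Definition scale_Rn {n} (r : R) (x : Rn R n) : Rn R n := [tuple (r * tnth x i)%R | i < n].

Lemma scale_cons n (r x : R) (y : Rn R n) :
  scale_Rn r (cons_Rn R n (x, y)) = cons_Rn R n ((r * x)%R, scale_Rn r y).
Proof.
apply: eq_from_tnth => i; rewrite tnth_mktuple.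
case: (unliftP ord0 i) => [j|] ->; rewrite ?tnth0// !tnthS tnth_mktuple//.
Qed.

Lemma measurable_scale2 n d (X : measurableType d) (r : X -> R) (x : X -> Rn R n) :
  measurable_fun [set: X] r -> measurable_fun [set: X] x ->
  measurable_fun [set: X] (fun z => scale_Rn (r z) (x z)).
Proof.
move=> mr mx; apply/measurable_fun_tnthP => i.
rewrite (_ : _ \o _ = (fun z => r z * tnth (x z) i)%R); last first.
  by apply/funext => z /=; rewrite tnth_mktuple.
apply: measurable_funM => //.
apply: (@measurableT_comp _ _ _ _ _ _ (fun y : Rn R n => tnth y i)) => //.
exact: (@measurable_tnth _ (measurableTypeR R)).
Qed.

Lemma iter_int_scale n (r : R) (f : Rn R n -> \bar R) : (0 < r)%R ->
  measurable_fun [set: Rn R n] f -> (forall x, 0 <= f x) ->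
  iter_int n f = (r ^+ n)%:E * iter_int n (fun y => f (scale_Rn r y)).
Proof.
move=> r0; elim: n f => [|n IH] f mf f0.
  by rewrite /= expr0 mul1e; congr f; apply/val_inj; rewrite /= enum_ord0.
have mc : measurable_fun [set: _] (fun z => f (cons_Rn R n z)).
  by apply: (measurableT_comp mf); exact: measurable_cons_Rn.
have mcx x : measurable_fun [set: _] (fun y => f (cons_Rn R n (x, y))).
  by apply: (measurableT_comp mc); exact: measurable_fun_pair.
rewrite /= -(integral_scale r)//; last 2 first.
- by apply: (measurable_fun_iter_int n _ _ (fun z => f (cons_Rn R n z))).
- by move=> x; apply: iter_int_ge0.
rewrite -ge0_integralZl//; last 3 first.
- apply: measurable_funTS.
  apply: (measurable_fun_iter_int n _ _
    (fun z => f (scale_Rn r (cons_Rn R n z)))) => //.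
  apply: (measurableT_comp mf); apply: measurable_scale2 => //.
  exact: measurable_cons_Rn.
- by move=> x _; apply: iter_int_ge0.
- by rewrite lee_fin exprn_ge0// ltW.
apply: eq_integral => u _; rewrite IH//.
rewrite muleA -EFinM -exprS; congr (_ * _).
by apply: eq_iter_int => y _; rewrite scale_cons.
Qed.

(* Tonelli on Phi(r, x) = f(x) h(rho x) (rho x / r)^n r^-1 1_(rho x <= r):
   integrating first in r gives the left-hand side (up to 1/n), while the change
   of variables x = r y separates the variables. *)
Lemma ge0_polar k (f rho : Rn R k.+1 -> R) (h : R -> R) :
  measurable_fun [set: Rn R k.+1] f -> measurable_fun [set: Rn R k.+1] rho ->
  measurable_fun [set: R] h ->
  (forall x, 0 <= f x)%R -> (forall x, 0 <= rho x)%R -> (forall s, 0 <= h s)%R ->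
  (forall x, (forall i, 0 < tnth x i) -> 0 < rho x)%R ->
  (forall r x, 0 < r -> (forall i, 0 < tnth x i) ->
    f (scale_Rn r x) = f x /\ rho (scale_Rn r x) = r * rho x)%R ->
  iter_int k.+1 (fun x => (f x * h (rho x))%:E) =
  k.+1%:R%:E * (\int[mu]_(s in `]0%R, +oo[) (h s * s `^ k%:R)%:E *
    iter_int k.+1 (fun x => (f x * (rho x <= 1)%R%:R)%:E)).
Proof.
move=> mf mrho mh f0 rho0 h0 rhop homog.
pose Phi (z : measurableTypeR R * Rn R k.+1) : R :=
  (f z.2 * h (rho z.2) * rho z.2 `^ k.+1%:R * (rho z.2 <= z.1)%R%:R * z.1 `^ (- k.+1%:R - 1))%R.
have Phi0 z : (0 <= Phi z)%R by rewrite !mulr_ge0 ?powR_ge0.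
have mPhi : measurable_fun [set: _] Phi.
  apply: measurable_funM; last first.
    exact: measurable_fun_powR.
  apply: measurable_funM; last first.
    apply: measurable_fun_natr_bool; apply: measurable_fun_ler => //.
    exact: measurableT_comp.
  apply: measurable_funM; last first.
    by apply: measurable_fun_powR; exact: measurableT_comp.
  apply: measurable_funM; first exact: measurableT_comp.
  apply: (measurableT_comp mh); exact: measurableT_comp.
pose Psi (z : measurableTypeR R * Rn R k.+1) : R :=
  (f z.2 * (rho z.2 <= 1)%R%:R * (rho z.2 * (h (z.1 * rho z.2) * (z.1 * rho z.2) `^ k%:R)))%R.
have Psi0 z : (0 <= Psi z)%R by rewrite !mulr_ge0 ?powR_ge0.
have mz : measurable_fun [set: measurableTypeR R * Rn R k.+1] (fun z => z.1 * rho z.2)%R.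
  by apply: measurable_funM => //; exact: measurableT_comp.
have mPsi : measurable_fun [set: _] Psi.
  apply: measurable_funM.
    apply: measurable_funM; first exact: measurableT_comp.
    apply: measurable_fun_natr_bool; apply: measurable_fun_ler => //.
    exact: measurableT_comp.
  apply: measurable_funM; first exact: measurableT_comp.
  apply: measurable_funM; first exact: (measurableT_comp mh).
  exact: measurable_fun_powR.
have kp : (0 < k.+1%:R :> R)%R by rewrite ltr0n.
transitivity (iter_int k.+1 (fun x => k.+1%:R%:E *
    \int[mu]_(r in `]0%R, +oo[) (Phi (r, x))%:E)).
  apply: eq_iter_int => x /rhop rx.
  (* With n = [k.+1], the integral of r^(-n-1) from [rho x] to infinity is rho(x)^(-n) / n, which
     cancels the power of [rho] in [Phi]. *)
  rewrite (_ : \int[mu]_(r in _) _ = ((f x * h (rho x) * rho x `^ k.+1%:R / k.+1%:R)%:E *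
      \int[mu]_(r in `[rho x, +oo[) (k.+1%:R * r `^ (- k.+1%:R - 1))%:E)); last first.
    rewrite -ge0_integralZl//; last 3 first.
    - apply: measurable_funTS; apply/measurable_EFinP; apply: measurable_funM => //.
    - by move=> r _; rewrite lee_fin mulr_ge0 ?powR_ge0.
    - by rewrite lee_fin !mulr_ge0 ?powR_ge0.
    rewrite [LHS]integral_mkcond [RHS]integral_mkcond; apply: eq_integral => r _.
    rewrite !patchE !mem_setE /= !in_itv/= !andbT /Phi/=.
    have [rr|rr] := leP (rho x) r; last by rewrite mulr0 mul0r if_same.
    rewrite (lt_le_trans rx rr) mulr1 -EFinM; congr EFin.
    by field.
  rewrite integral_powRN_tail// -!EFinM; congr EFin.
  rewrite powRN; field.
  by rewrite gt_eqF ?powR_gt0//= nat1r pnatr_eq0.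
rewrite iter_intZl//; last 2 first.
- apply: (measurable_fun_integral_on _ _ _ _ _ mu _
    (fun z => (Phi (z.2, z.1))%:E)) => //; last by move=> z; rewrite lee_fin.
  by apply/measurable_EFinP; apply: (measurableT_comp mPhi); exact: measurable_fun_pair.
- by move=> x; apply: integral_ge0 => r _; rewrite lee_fin.
congr (_ * _).
rewrite -(iter_int_swap _ _ _ mu _ (fun z => (Phi z)%:E))//; last exact/measurable_EFinP.
(* Scaling by r contributes r^n and, by homogeneity, turns the condition rho(x) <= r into rho(y) <=
   1, which no longer involves r. *)
transitivity (\int[mu]_(r in `]0%R, +oo[) iter_int k.+1 (fun y => (Psi (r, y))%:E)).
  apply: eq_integral => r r0'.
  have r0 : (0 < r)%R by move: r0'; rewrite inE/= in_itv/= andbT.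
  rewrite (iter_int_scale _ r)//; last 2 first.
  - by apply/measurable_EFinP; apply: (measurableT_comp mPhi); exact: measurable_fun_pair.
  - by move=> x; rewrite lee_fin.
  rewrite -iter_intZl//; last 3 first.
  - apply/measurable_EFinP; apply: (measurableT_comp mPhi); apply: measurable_fun_pair => //.
    exact: measurable_scale2.
  - by move=> x; rewrite lee_fin.
  - by rewrite lee_fin exprn_ge0// ltW.
  apply: eq_iter_int => y y0; rewrite -EFinM; congr EFin.
  have [fE rhoE] := homog r y r0 y0; have ry := rhop y y0.
  rewrite /Phi /Psi /= fE rhoE.
  have -> : (r * rho y <= r)%R = (rho y <= 1)%R by rewrite -{2}(mulr1 r) ler_pM2l.
  rewrite !powR_mulrn ?mulr_ge0 ?(ltW r0)//.
  have -> : (- k.+1%:R - 1 = - k.+2%:R :> R)%R by rewrite -[in RHS]natr1 opprD.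
  rewrite powR_invn ?(ltW r0)// !exprS; field.
  by rewrite ?expf_neq0 ?gt_eqF.
rewrite (iter_int_swap _ _ _ mu _ (fun z => (Psi z)%:E))//; last exact/measurable_EFinP.
rewrite -iter_intZl//; last 3 first.
- apply/measurable_EFinP; apply: measurable_funM => //.
  by apply: measurable_fun_natr_bool; exact: measurable_fun_ler.
- by move=> x; rewrite lee_fin mulr_ge0.
- by apply: integral_ge0 => s _; rewrite lee_fin mulr_ge0// powR_ge0.
apply: eq_iter_int => x /rhop rx.
transitivity (\int[mu]_(s in `]0%R, +oo[) ((f x * (rho x <= 1)%R%:R)%:E *
    (rho x * (h (s * rho x) * (s * rho x) `^ k%:R))%:E)).
  by apply: eq_integral => s _; rewrite -EFinM.
rewrite ge0_integralZl//; last 3 first.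
- apply: measurable_funTS; apply/measurable_EFinP; apply: measurable_funM => //.
  apply: measurable_funM; first by apply: measurableT_comp mh _; exact: mulrr_measurable.
  by apply: measurable_fun_powR; exact: mulrr_measurable.
- by move=> r _; rewrite lee_fin !mulr_ge0// powR_ge0.
- by rewrite lee_fin mulr_ge0.
rewrite muleC; congr (_ * _).
(* Scaling the radial variable by [rho x] uses up the factor [rho x] and frees the radial integral
   of x. *)
transitivity (\int[mu]_(s in `]0%R, +oo[)
    ((rho x)%:E * (h (rho x * s) * (rho x * s) `^ k%:R)%:E)).
  by apply: eq_integral => s _; rewrite -EFinM (mulrC s).
apply: (integral_scale (rho x) (fun s => (h s * s `^ k%:R)%:E)) => //.
- by apply/measurable_EFinP; apply: measurable_funM => //; exact: measurable_fun_powR.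
- by move=> s; rewrite lee_fin mulr_ge0 ?powR_ge0.
Qed.

End polar.

(** * The radial projection onto the simplex *)

Section radial.
Context {R : realType} (p : R) (hp : 0 < p).

Definition pnorm {n} (x : Rn R n) : R := (\sum_(i < n) tnth x i `^ p) `^ p^-1.

Definition radial {n} (x : Rn R n) : Rn R n := scale_Rn (pnorm x)^-1 x.

Lemma pnorm_ge0 n (x : Rn R n) : 0 <= pnorm x.
Proof. exact: powR_ge0. Qed.

Lemma pnormX n (x : Rn R n) : pnorm x `^ p = \sum_(i < n) tnth x i `^ p.
Proof.
rewrite -powRrM mulVf ?gt_eqF// powRr1//.
by apply: sumr_ge0 => i _; exact: powR_ge0.
Qed.

Lemma measurable_tnth_Rn n (i : 'I_n) :
  measurable_fun [set: Rn R n] (fun x : Rn R n => tnth x i : R).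
Proof. exact: (@measurable_tnth _ (measurableTypeR R)). Qed.

Lemma measurable_pnorm n : measurable_fun [set: Rn R n] (@pnorm n).
Proof.
apply: measurable_fun_powR.
rewrite (_ : (fun x : Rn R n => _) =
  (fun x : Rn R n => \sum_(i <- enum 'I_n) tnth x i `^ p)); last first.
  by apply/funext => x; rewrite big_enum.
apply: measurable_sum => i.
by apply: measurable_fun_powR; exact: measurable_tnth_Rn.
Qed.

Lemma measurable_radial n : measurable_fun [set: Rn R n] (@radial n).
Proof.
apply: measurable_scale2 => //.
rewrite (_ : (fun z : Rn R n => _) = (fun z : Rn R n => pnorm z `^ (-1))).
  by apply: measurable_fun_powR; exact: measurable_pnorm.
by apply/funext => z; rewrite powR_inv1 ?pnorm_ge0.
Qed.

Lemma pnorm_gt0 n (x : Rn R n) : (0 < n)%N -> (forall i, 0 < tnth x i) -> 0 < pnorm x.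
Proof.
move=> n0 x0; apply: powR_gt0.
rewrite (bigD1 (Ordinal n0))//= ltr_pwDl ?powR_gt0//.
by apply: sumr_ge0 => i _; exact: powR_ge0.
Qed.

Lemma pnorm_scale n (r : R) (x : Rn R n) : 0 <= r -> orthant n x ->
  pnorm (scale_Rn r x) = r * pnorm x.
Proof.
move=> r0 x0; rewrite /pnorm.
under eq_bigr do rewrite tnth_mktuple powRM//.
rewrite -mulr_sumr powRM ?powR_ge0//; last first.
  by apply: sumr_ge0 => i _; exact: powR_ge0.
by rewrite -powRrM mulfV ?gt_eqF// powRr1.
Qed.

Lemma scale_RnA n (r s : R) (x : Rn R n) : scale_Rn r (scale_Rn s x) = scale_Rn (r * s) x.
Proof. by apply: eq_from_tnth => i; rewrite !tnth_mktuple mulrA. Qed.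

Lemma scale_Rn1 n (x : Rn R n) : scale_Rn 1 x = x.
Proof. by apply: eq_from_tnth => i; rewrite !tnth_mktuple mul1r. Qed.

Lemma orthant_scale n (r : R) (x : Rn R n) : 0 <= r -> orthant n x ->
  orthant n (scale_Rn r x).
Proof. by move=> r0 x0 i; rewrite tnth_mktuple mulr_ge0. Qed.

Lemma radial_scale n (r : R) (x : Rn R n) : 0 < r -> orthant n x ->
  radial (scale_Rn r x) = radial x.
Proof.
move=> r0 x0; rewrite /radial pnorm_scale// ?ltW// scale_RnA.
by rewrite invfM mulrAC mulVf ?mul1r// gt_eqF.
Qed.

Lemma radialK n (x : Rn R n) : 0 < pnorm x -> scale_Rn (pnorm x) (radial x) = x.
Proof. by move=> x0; rewrite /radial scale_RnA mulfV ?scale_Rn1// gt_eqF. Qed.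

Lemma simplex_orthant n (x : Rn R n) : simplex p n x -> orthant n x.
Proof. by case. Qed.

Lemma pnorm_simplex n (x : Rn R n) : simplex p n x -> pnorm x = 1.
Proof. by case=> _ x1; rewrite /pnorm x1 powR1. Qed.

Lemma radial_simplex n (x : Rn R n) : orthant n x -> 0 < pnorm x ->
  simplex p n (radial x).
Proof.
move=> x0 nx0; have r0 : 0 <= (pnorm x)^-1 by rewrite invr_ge0 ltW.
split; first exact: orthant_scale.
rewrite -pnormX pnorm_scale// mulVf ?gt_eqF//.
by rewrite powR1.
Qed.

Lemma measurable_simplex n : measurable (simplex p n).
Proof.
rewrite (_ : simplex p n = orthant n `&` (fun x => pnorm x `^ p) @^-1` [set 1]).
  apply: measurableI; first exact: measurable_orthant.
  rewrite -[X in measurable X]setTI; apply: measurable_fun_powR => //.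
  exact: measurable_pnorm.
apply/seteqP; split=> x /= -[x0 x1]; split=> //.
  by rewrite pnormX.
by rewrite -pnormX.
Qed.

(** A cone is defined as an image, which hides its measurability. Away from the origin it is a
    preimage under [radial]; the scale t = 0 adds the origin exactly when [A] meets the simplex. *)
Lemma unit_coneE n (A : set (Rn R n)) : unit_cone (A `&` simplex p n) =
  (orthant n `&` [set x | 0 < pnorm x <= 1] `&` radial @^-1` A) `|`
  (if `[< A `&` simplex p n !=set0 >] then orthant n `&` [set x | pnorm x = 0] else set0).
Proof.
apply/seteqP; split.
  move=> _ [t t01 [x [Ax Sx] <-]]; rewrite -/(scale_Rn t x).
  move: t01; rewrite /= in_itv/= => /andP[t0 t1].
  have x0 := simplex_orthant _ _ Sx.
  have nE : pnorm (scale_Rn t x) = t by rewrite pnorm_scale// pnorm_simplex// mulr1.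
  have [->|tn0] := eqVneq t 0.
    right; rewrite asboolT; last by exists x.
    by split; [exact: orthant_scale|rewrite /= pnorm_scale// mul0r].
  have tp : 0 < t by rewrite lt0r tn0.
  left; split; last first.
    by rewrite /= radial_scale// /radial pnorm_simplex// invr1 scale_Rn1.
  by split; [exact: orthant_scale|rewrite /= nE tp t1].
move=> x [[[x0 /= /andP[nx0 nx1]] Ax]|].
  exists (pnorm x); first by rewrite /= in_itv/= pnorm_ge0.
  by exists (radial x); [split => //; exact: radial_simplex|exact: radialK].
case: ifPn => // /asboolP[y ASy] [x0 /= nx0].
exists 0; first by rewrite /= in_itv/= lexx ler01.
exists y => //; apply: eq_from_tnth => i; rewrite tnth_mktuple mul0r.
have : pnorm x `^ p = 0 by rewrite nx0 powR0// gt_eqF.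
rewrite pnormX => /eqP; rewrite psumr_eq0; last by move=> ? _; exact: powR_ge0.
by move=> /allP/(_ i); rewrite mem_index_enum => /(_ isT) /eqP/powR_eq0_eq0.
Qed.

Lemma measurable_unit_cone n (A : set (Rn R n)) : measurable A ->
  measurable (unit_cone (A `&` simplex p n)).
Proof.
move=> mA; rewrite unit_coneE.
have mp (B : set R) : measurable B -> measurable (@pnorm n @^-1` B).
  by move=> mB; rewrite -[X in measurable X]setTI; exact: measurable_pnorm.
apply: measurableU.
  apply: measurableI; last first.
    by rewrite -[X in measurable X]setTI; exact: measurable_radial.
  apply: measurableI; first exact: measurable_orthant.
  rewrite (_ : [set x | _] = @pnorm n @^-1` `]0, 1]%classic); first exact: mp.
  by apply/seteqP; split=> x /=; rewrite in_itv.
case: ifP => _ //; apply: measurableI; first exact: measurable_orthant.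
exact: (mp [set 0]).
Qed.

(* The cone and its description in polar coordinates may differ at the origin,
   where radial takes a junk value; iter_int does not see that point. *)
Lemma lebesgue_unit_cone n (A : set (Rn R n)) : (0 < n)%N -> measurable A ->
  lebesgue_Rn n (unit_cone (A `&` simplex p n)) =
  iter_int n (fun x => (\1_A (radial x) * (pnorm x <= 1)%R%:R)%:E).
Proof.
move=> n0 mA; have mU := measurable_unit_cone n A mA.
transitivity (iter_int n (fun x => (\1_(unit_cone (A `&` simplex p n)) x)%:E)).
  rewrite -integral_orthant; last 2 first.
  - by apply/measurable_EFinP; exact: measurable_indic.
  - by move=> x; rewrite lee_fin.
  rewrite integral_indic//; last exact: measurable_orthant.
  congr (lebesgue_Rn n _); apply/esym/setIidl; rewrite unit_coneE => x [[[]]//|].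
  by case: ifP => // _ [].
apply: eq_iter_int => x x0.
have nx0 : 0 < pnorm x by exact: pnorm_gt0.
have ox : orthant n x by move=> i; exact: ltW.
rewrite !indicE unit_coneE -natrM mulnb; congr (_%:R%:E).
congr nat_of_bool; apply/idP/idP.
  rewrite inE => -[[[_ /andP[_ ->]] /= Ax]|]; first by rewrite mem_set.
  by case: ifP => // _ [_ /= nx]; move: nx0; rewrite nx ltxx.
move=> /andP[]; rewrite !inE => Ax nx1; left.
by split => //; split => //=; rewrite nx0.
Qed.

End radial.

(** Valid for any set function: the integral over [D] is by definition that of the extension by
    zero. *)
Lemma integral_setfun_indic d (T : measurableType d) (R : realType)
    (nu : set T -> \bar R) (D : set T) (f : T -> R) :
  (\int[nu]_(x in D) (f x)%:E = \int[nu]_x (f x * \1_D x)%:E)%E.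
Proof.
rewrite /integral patch_setT.
suff -> : (EFin \o f) \_ D = (fun x => (f x * \1_D x)%:E) by [].
apply/funext => x; rewrite patchE indicE.
by case: (x \in D); rewrite ?mulr1 ?mulr0.
Qed.

(** * The cone measure and theta as radial images of densities *)

Section theta_formula.
Context {R : realType} (p : R) (hp : 0 < p) (n : nat) (n0 : (0 < n)%N).
(** [l] is the volume of the positive part of the unit ball, and [c] the integral over it of the
    density composed with [radial]. That both are positive reals is derived later from the polar
    formula; it makes the quotients of extended reals true quotients. *)
Variables (b l c : R).
Hypotheses (l0 : 0 < l) (c0 : 0 < c).
Hypothesis (lE : iter_int n (fun x : Rn R n => ((pnorm p x <= 1)%R%:R)%:E) = l%:E).
Local Open Scope ereal_scope.

Let ball (x : Rn R n) : R := (pnorm p x <= 1)%R%:R.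

Let mball : measurable_fun [set: Rn R n] ball.
Proof.
apply: measurable_fun_natr_bool; apply: measurable_fun_ler => //.
exact: measurable_pnorm.
Qed.

Let morth : measurable_fun [set: Rn R n] (\1_(@orthant R n) : _ -> R).
Proof. by apply: measurable_indic; exact: measurable_orthant. Qed.

Let integral_orth (F : Rn R n -> R) : measurable_fun [set: Rn R n] F ->
  (forall x, 0 <= F x)%R ->
  \int[lebesgue_Rn n]_x (\1_(@orthant R n) x * F x)%:E = iter_int n (EFin \o F).
Proof.
move=> mF F0; rewrite -integral_orthant; last 2 first.
- exact/measurable_EFinP.
- by move=> x; rewrite lee_fin.
by rewrite [RHS]integral_indicM; apply: eq_integral => x _; rewrite EFinM.
Qed.

(** The cone measure is the image under [radial] of the uniform distribution on the positive part of
    the unit ball, the form required by [ge0_integral_transfer]. *)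
Lemma cone_measureE (A : set (Rn R n)) : measurable A -> cone_measure p n A =
  \int[lebesgue_Rn n]_x (l^-1 * (\1_(@orthant R n) x * ball x) * \1_A (radial p x))%:E.
Proof.
move=> mA; rewrite /cone_measure lebesgue_unit_cone//.
have -> : unit_cone (simplex p n) = unit_cone ([set: Rn R n] `&` simplex p n).
  by rewrite setTI.
rewrite lebesgue_unit_cone//.
have -> : iter_int n (fun x => (\1_[set: Rn R n] (radial p x) * (pnorm p x <= 1)%R%:R)%:E) = l%:E.
  by rewrite -lE; apply: eq_iter_int => x _; rewrite indicT mul1r.
have mAr : measurable_fun [set: Rn R n] (fun x => \1_A (radial p x) : R).
  by apply: measurableT_comp; [exact: measurable_indic|exact: measurable_radial].
rewrite inver gt_eqF// muleC.
rewrite -iter_intZl; last 3 first.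
- by apply/measurable_EFinP; exact: measurable_funM.
- by move=> x; rewrite lee_fin mulr_ge0.
- by rewrite lee_fin invr_ge0 ltW.
rewrite -[LHS](integral_orth (fun x => l^-1 * (\1_A (radial p x) * ball x))%R); last 2 first.
- by apply: measurable_funM => //; apply: measurable_funM.
- by move=> x; rewrite !mulr_ge0 ?invr_ge0 ?(ltW l0) ?(ltW c0).
by apply: eq_integral => x _; congr EFin; ring.
Qed.

Lemma integral_cone (F : Rn R n -> R) : measurable_fun [set: Rn R n] F ->
  (forall x, 0 <= F x)%R ->
  \int[cone_measure p n]_(x in simplex p n) (F x)%:E =
  (l^-1)%:E * iter_int n (fun x => (F (radial p x) * ball x)%:E).
Proof.
move=> mF F0; have mr := @measurable_radial R p n.
have mFr : measurable_fun [set: Rn R n] (fun x => F (radial p x)).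
  exact: measurableT_comp.
rewrite integral_setfun_indic.
have mS : measurable_fun [set: Rn R n] (\1_(@simplex R p n) : _ -> R).
  by apply: measurable_indic; exact: measurable_simplex.
rewrite (ge0_integral_transfer _ _ _ _ _
  (@lebesgue_Rn R n) (@radial R p n) _ mr _ _ _ _ cone_measureE); last 4 first.
- by apply: measurable_funM => //; apply: measurable_funM.
- by move=> x; rewrite !mulr_ge0 ?invr_ge0 ?(ltW l0) ?(ltW c0).
- by apply/measurable_EFinP; exact: measurable_funM.
- by move=> x; rewrite lee_fin mulr_ge0.
rewrite -iter_intZl; last 3 first.
- by apply/measurable_EFinP; exact: measurable_funM.
- by move=> x; rewrite lee_fin mulr_ge0.
- by rewrite lee_fin invr_ge0 ltW.
transitivity (iter_int n (fun x =>
  (l^-1 * (F (radial p x) * \1_(@simplex R p n) (radial p x) * ball x))%:E)).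
  rewrite -(integral_orth (fun x =>
    l^-1 * (F (radial p x) * \1_(@simplex R p n) (radial p x) * ball x))%R);
    last 2 first.
  - apply: measurable_funM => //; apply: measurable_funM => //.
    by apply: measurable_funM => //; exact: measurableT_comp.
  - by move=> x; rewrite !mulr_ge0 ?invr_ge0 ?(ltW l0) ?(ltW c0).
  by apply: eq_integral => x _; rewrite -EFinM; congr EFin; ring.
apply: eq_iter_int => x x0; rewrite -EFinM; congr EFin.
rewrite [X in (_ * X * _)%R](_ : _ = 1%R) ?mulr1// indicE mem_set//.
by apply: radial_simplex => //; [move=> i; exact: ltW|exact: pnorm_gt0].
Qed.

Hypothesis (cE : iter_int n (fun x => (prod_powR b (radial p x) * ball x)%:E) = c%:E).

Lemma measurable_prod_powR : measurable_fun [set: Rn R n] (@prod_powR R b n).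
Proof.
rewrite (_ : prod_powR b =
  (fun x : Rn R n => \prod_(i <- enum 'I_n) tnth x i `^ b)%R); last first.
  by apply/funext => x; rewrite big_enum.
apply: measurable_prod => i _.
by apply: measurable_fun_powR; exact: measurable_tnth_Rn.
Qed.

Lemma prod_powR_ge0 (x : Rn R n) : (0 <= prod_powR b x)%R.
Proof. by apply: prodr_ge0 => i _; exact: powR_ge0. Qed.

Lemma theta_normE : theta_norm p b n = (c / l)%:E.
Proof.
rewrite /theta_norm (integral_cone _ measurable_prod_powR prod_powR_ge0).
by rewrite cE -EFinM mulrC.
Qed.

(** The normalising constant is [c / l], so the volume [l] cancels and only [c] survives. *)
Lemma thetaE (A : set (Rn R n)) : measurable A -> theta p b n A =
  \int[lebesgue_Rn n]_x (c^-1 * (\1_(@orthant R n) x * (prod_powR b (radial p x) * ball x))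
    * \1_A (radial p x))%:E.
Proof.
move=> mA.
have mAr : measurable_fun [set: Rn R n] (fun x => \1_A (radial p x) : R).
  by apply: measurableT_comp; [exact: measurable_indic|exact: measurable_radial].
have mpr : measurable_fun [set: Rn R n] (fun x => prod_powR b (radial p x)).
  by apply: measurableT_comp; [exact: measurable_prod_powR|exact: measurable_radial].
transitivity (\int[cone_measure p n]_(x in simplex p n)
   (l / c * (prod_powR b x * \1_A x))%:E).
  rewrite [RHS]integral_setfun_indic /theta theta_normE.
  have -> : (c / l)%:E^-1 = (l / c)%:E by rewrite inver gt_eqF ?divr_gt0// invf_div.
  transitivity (\int[cone_measure p n]_(x in A `&` simplex p n)
    (l / c * prod_powR b x)%:E).
    by congr integral; apply/funext => x; rewrite EFinM.
  rewrite integral_setfun_indic; congr integral; apply/funext => x; congr EFin.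
  by rewrite indicI/= !mulrA.
rewrite integral_cone; last 2 first.
- apply: measurable_funM => //; apply: measurable_funM => //.
  exact: measurable_prod_powR.
- by move=> x; rewrite !mulr_ge0 ?invr_ge0 ?prod_powR_ge0 ?(ltW l0) ?(ltW c0).
rewrite -iter_intZl; last 3 first.
- apply/measurable_EFinP; apply: measurable_funM => //; apply: measurable_funM => //.
  exact: measurable_funM.
- by move=> x; rewrite lee_fin !mulr_ge0 ?prod_powR_ge0 ?invr_ge0 ?(ltW l0) ?(ltW c0).
- by rewrite lee_fin invr_ge0 ltW.
rewrite -[LHS](integral_orth (fun x =>
  l^-1 * (l / c * (prod_powR b (radial p x) * \1_A (radial p x)) * ball x))%R);
  last 2 first.
- apply: measurable_funM => //; apply: measurable_funM => //.
  by apply: measurable_funM => //; exact: measurable_funM.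
- by move=> x; rewrite !mulr_ge0 ?prod_powR_ge0 ?invr_ge0 ?(ltW l0) ?(ltW c0).
apply: eq_integral => x _; congr EFin; field.
by rewrite !gt_eqF.
Qed.

Lemma integral_theta (F : Rn R n -> R) : measurable_fun [set: Rn R n] F ->
  (forall x, 0 <= F x)%R ->
  \int[theta p b n]_(x in simplex p n) (F x)%:E =
  (c^-1)%:E * iter_int n (fun x => (prod_powR b (radial p x) * F (radial p x) * ball x)%:E).
Proof.
move=> mF F0; have mr := @measurable_radial R p n.
have mFr : measurable_fun [set: Rn R n] (fun x => F (radial p x)).
  exact: measurableT_comp.
have mpr : measurable_fun [set: Rn R n] (fun x => prod_powR b (radial p x)).
  by apply: measurableT_comp; [exact: measurable_prod_powR|exact: measurable_radial].
rewrite integral_setfun_indic.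
have mS : measurable_fun [set: Rn R n] (\1_(@simplex R p n) : _ -> R).
  by apply: measurable_indic; exact: measurable_simplex.
rewrite (ge0_integral_transfer _ _ _ _ _
  (@lebesgue_Rn R n) (@radial R p n) _ mr _ _ _ _ thetaE); last 4 first.
- by apply: measurable_funM => //; apply: measurable_funM => //; apply: measurable_funM.
- by move=> x; rewrite !mulr_ge0 ?prod_powR_ge0 ?invr_ge0 ?(ltW l0) ?(ltW c0).
- by apply/measurable_EFinP; exact: measurable_funM.
- by move=> x; rewrite lee_fin mulr_ge0.
rewrite -iter_intZl; last 3 first.
- apply/measurable_EFinP; apply: measurable_funM => //; exact: measurable_funM.
- by move=> x; rewrite lee_fin !mulr_ge0 ?prod_powR_ge0.
- by rewrite lee_fin invr_ge0 ltW.
pose G x := (c^-1 * (prod_powR b (radial p x) * F (radial p x) *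
  \1_(@simplex R p n) (radial p x) * ball x))%R.
transitivity (iter_int n (EFin \o G)).
  rewrite -integral_orth; last 2 first.
  - apply: measurable_funM => //; apply: measurable_funM => //.
    by apply: measurable_funM; [exact: measurable_funM|exact: measurableT_comp].
  - by move=> x; rewrite !mulr_ge0 ?prod_powR_ge0 ?invr_ge0 ?(ltW l0) ?(ltW c0).
  by apply: eq_integral => x _; rewrite -EFinM /G; congr EFin; ring.
apply: eq_iter_int => x x0; rewrite /G/= -EFinM; congr EFin.
rewrite [X in (_ * X * _)%R](_ : _ = 1%R) ?mulr1// indicE mem_set//.
by apply: radial_simplex => //; [move=> i; exact: ltW|exact: pnorm_gt0].
Qed.

End theta_formula.

(** * Best approximation and order statistics *)

Section best_approx_infty.
Context {R : realType}.
Local Notation mu := (@lebesgue_measure R).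

Definition exceed {n} (t : R) (x : Rn R n) : nat := (\sum_(i < n) (t < `|tnth x i|)%R)%N.

Lemma exceedE n (t : R) (x : Rn R n) : exceed t x = #|[pred i | t < `|tnth x i|]|.
Proof.
rewrite /exceed -sum1_card [RHS]big_mkcond; apply: eq_bigr => i _.
by rewrite inE; case: (t < _).
Qed.

Let err n (x y : Rn R n) : R := lq_norm +oo%E [tuple tnth x i - tnth y i | i < n].

Let le_err n (x y : Rn R n) i : `|tnth x i - tnth y i| <= err n x y.
Proof.
have := le_bigmax 0 (fun i => `|tnth [tuple tnth x i - tnth y i | i < n] i|) i.
by rewrite tnth_mktuple.
Qed.

Let err_le n (x y : Rn R n) (t : R) : 0 <= t -> (forall i, `|tnth x i - tnth y i| <= t) ->
  err n x y <= t.
Proof. by move=> t0 H; apply: bigmax_le => // i _; rewrite tnth_mktuple. Qed.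

Let err_ge0 n (x y : Rn R n) : 0 <= err n x y.
Proof. exact: bigmax_ge_id. Qed.

Let zeroRn n : Rn R n := [tuple 0 : R | i < n].

Lemma best_approx_ge0 n m (x : Rn R n) : 0 <= best_approx +oo%E m x.
Proof.
apply: lb_le_inf.
  exists (err n x (zeroRn n)), (zeroRn n) => //=.
  by rewrite eq_card0// => i; rewrite !inE tnth_mktuple eqxx.
by move=> _ [y _ <-]; exact: err_ge0.
Qed.

(** The error is the (m+1)-st largest modulus, read through level counts. If at most m coordinates
    exceed t, keeping exactly these costs at most t; if more do, every m-sparse y vanishes at one of
    them. *)
Lemma lt_best_approx n m (x : Rn R n) (t : R) : 0 <= t ->
  (t < best_approx +oo%E m x) = (m < exceed t x)%N.
Proof.
move=> t0; rewrite exceedE; apply/idP/idP.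
  rewrite ltNge ltnNge; apply: contra => Jm; apply: (@le_trans _ _ (err n x
    [tuple if t < `|tnth x i| then tnth x i else 0 | i < n])).
    apply: ge_inf; first by exists 0 => _ [y _ <-]; exact: err_ge0.
    exists [tuple if t < `|tnth x i| then tnth x i else 0 | i < n] => //=.
    apply: (leq_trans _ Jm); apply: subset_leq_card; apply/fintype.subsetP => i.
    by rewrite !inE tnth_mktuple; case: ifP => //; rewrite eqxx.
  apply: err_le => // i; rewrite tnth_mktuple; case: ltP => // xt.
    by rewrite subrr normr0.
  by rewrite subr0.
move=> Jm.
have [i0 Ji0] : exists i, t < `|tnth x i|.
  have /card_gt0P[i] := leq_ltn_trans (leq0n m) Jm.
  by rewrite inE; exists i.
(* The smallest modulus above t bounds all errors from below, so their infimum still exceeds t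
   strictly. *)
case: (@Order.TotalTheory.arg_minP _ _ _ i0 [pred i | t < `|tnth x i|] (fun i => `|tnth x i|)) => //= j tj jmin.
apply: (lt_le_trans tj); apply: lb_le_inf.
  exists (err n x (zeroRn n)), (zeroRn n) => //=.
  by rewrite eq_card0// => i; rewrite !inE tnth_mktuple eqxx.
move=> _ [y /= ym <-].
have [i ti yi] : exists2 i, t < `|tnth x i| & tnth y i = 0.
  apply/not_exists2P => H.
  have : (#|[pred i | (t < `|tnth x i|)%R]| <= #|[pred i | tnth y i != 0%R :> R]|)%N.
    apply: subset_leq_card; apply/fintype.subsetP => i; rewrite !inE => ti.
    by apply/eqP => yi; case: (H i) => [/(_ ti)|/(_ yi)].
  by rewrite leqNgt (leq_ltn_trans ym).
apply: (le_trans (jmin i ti)); apply: le_trans (le_err _ _ y i).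
by rewrite yi subr0.
Qed.

Lemma measurable_exceed n m : measurable_fun [set: measurableTypeR R * Rn R n]
  (fun z => (m <= exceed z.1 z.2)%N).
Proof.
rewrite (_ : (fun z => _) = (fun z : R * Rn R n =>
   (m%:R : R) <= \sum_(i <- enum 'I_n) (z.1 < `|tnth z.2 i|)%R%:R)); last first.
  apply/funext => z; rewrite -(ler_nat R) /exceed natr_sum big_enum//.
apply: measurable_fun_ler => //; apply: measurable_sum => i.
apply: measurable_fun_natr_bool; apply: measurable_fun_ltr => //.
apply: measurableT_comp => //.
apply: (@measurableT_comp _ _ _ _ _ _ (fun x : Rn R n => tnth x i)) => //.
exact: (@measurable_tnth _ (measurableTypeR R)).
Qed.

(** Layer-cake formula: it turns the mean error into an integral over t of exceedance
    probabilities. *)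
Lemma best_approx_layer n m (x : Rn R n) : ((best_approx +oo m x)%:E =
  \int[mu]_(t in `]0%R, +oo[) ((m < exceed t x)%N%:R)%:E)%E.
Proof.
set s := best_approx _ _ _.
have [s0|] := ltP 0 s; last first.
  rewrite le_eqVlt ltNge best_approx_ge0 orbF => /eqP s0.
  rewrite s0 integral0_eq// => t; rewrite /= in_itv/= andbT => t0.
  by rewrite -lt_best_approx ?(ltW t0)// -/s s0 ltNge (ltW t0).
rewrite -(lebesgue_itv0 _ s0).
transitivity (\int[mu]_(t in `]0%R, +oo[) (\1_(`]0%R, s[%classic) t)%:E)%E.
  rewrite integral_indic//; congr (mu _).
  by apply/seteqP; split=> t /=; rewrite !in_itv/= ?andbT; [move=> /andP[-> ->]|case=> /andP[-> ->]].
apply: eq_integral => t; rewrite inE/= in_itv/= andbT => t0.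
rewrite -lt_best_approx ?(ltW t0)// indicE; congr ((nat_of_bool _)%:R%:E).
by apply/idP/idP; rewrite inE/= in_itv/= t0.
Qed.

(** The definition is an infimum over uncountably many y; measurability comes instead from the
    layer-cake integral of a jointly measurable count. *)
Lemma measurable_best_approx n m :
  measurable_fun [set: Rn R n] (fun x : Rn R n => best_approx +oo%E m x).
Proof.
apply/measurable_EFinP.
rewrite (_ : EFin \o _ = (fun x : Rn R n =>
  \int[mu]_(t in `]0%R, +oo[) ((m < exceed t x)%N%:R)%:E)%E); last first.
  by apply/funext => x /=; rewrite best_approx_layer.
apply: (measurable_fun_integral_on _ _ _ _ _ mu _
  (fun z : Rn R n * measurableTypeR R => ((m < exceed z.2 z.1)%N%:R)%:E)) => //.
  apply/measurable_EFinP; apply: measurable_fun_natr_bool.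
  apply: (@measurableT_comp _ _ _ _ _ _ (fun z : R * Rn R n => (m < exceed z.1 z.2)%N)
    _ (fun z : Rn R n * R => (z.2, z.1))).
    exact: measurable_exceed.
  exact: measurable_fun_pair.
Qed.

(** Level counts scale exactly and determine the error; the two inequalities test the levels
    sigma(x) and sigma(r x) / r. *)
Lemma best_approx_scale n m (r : R) (x : Rn R n) : 0 < r ->
  best_approx +oo%E m (scale_Rn r x) = r * best_approx +oo%E m x.
Proof.
move=> r0.
have H t : 0 <= t -> (r * t < best_approx +oo%E m (scale_Rn r x)) = (t < best_approx +oo%E m x).
  move=> t0; rewrite !lt_best_approx// ?mulr_ge0 ?(ltW r0)//.
  congr (_ < _)%N; apply: eq_bigr => i _.
  by rewrite tnth_mktuple normrM (gtr0_norm r0) ltr_pM2l.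
apply/eqP; rewrite eq_le; apply/andP; split; rewrite leNgt; apply/negP => h.
  by have := H _ (best_approx_ge0 n m x); rewrite h ltxx.
have := H (best_approx +oo%E m (scale_Rn r x) / r).
rewrite (mulrC r (_ / r)) divfK ?gt_eqF// ltxx divr_ge0 ?best_approx_ge0 ?(ltW r0)//.
by move=> /(_ isT)/esym; rewrite ltr_pdivrMr// (mulrC _ r) h.
Qed.

End best_approx_infty.

(** * Exceedance counts of independent coordinates *)

Section tail_prob.
Context {R : realType}.

(* Probability that at least m of n independent events of probability 1 - y
   occur, computed by conditioning on the first event. *)
Fixpoint tail_prob (y : R) (n m : nat) : R :=
  match n, m with
  | _, 0 => 1
  | 0, _.+1 => 0
  | n'.+1, m'.+1 => (1 - y) * tail_prob y n' m' + y * tail_prob y n' m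
  end.

Lemma tail_prob0 y n : tail_prob y n 0 = 1.
Proof. by case: n. Qed.

Local Notation mu := (@lebesgue_measure R).
Local Open Scope ereal_scope.

Lemma exceed_cons n t x (y : Rn R n) : exceed t (cons_Rn R n (x, y)) = ((t < `|x|)%R + exceed t y)%N.
Proof.
rewrite /exceed big_ord_recl tnth0; congr addn.
by apply: eq_bigr => i _; rewrite tnthS.
Qed.

(** The weight [w] has total mass [c] and mass [a] on (0, t], so [a / c] is the distribution
    function at t of the normalised weight. Integrating out the first coordinate reproduces the
    recursion of [tail_prob]. *)
Lemma iter_int_tail (w : R -> R) (t a c : R) n m : (0 <= t)%R -> (0 < c)%R ->
  measurable_fun [set: R] w -> (forall x, 0 <= w x)%R ->
  \int[mu]_(x in `]0%R, +oo[) (w x)%:E = c%:E ->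
  \int[mu]_(x in `]0%R, +oo[) (w x * (x <= t)%R%:R)%:E = a%:E ->
  iter_int n (fun x => (\prod_(i < n) w (tnth x i) * (m <= exceed t x)%N%:R)%:E) =
  (c ^+ n * tail_prob (a / c) n m)%:E.
Proof.
move=> t0 c0 mw w0 cE aE.
have mwt : measurable_fun [set: R] (fun x => w x * (x <= t)%R%:R)%R.
  by apply: measurable_funM => //; apply: measurable_fun_natr_bool; exact: measurable_fun_ler.
have mwt' : measurable_fun [set: R] (fun x => w x * (t < x)%R%:R)%R.
  by apply: measurable_funM => //; apply: measurable_fun_natr_bool; exact: measurable_fun_ltr.
have bE : \int[mu]_(x in `]0%R, +oo[) (w x * (t < x)%R%:R)%:E = (c - a)%:E.
  have : c%:E = \int[mu]_(x in `]0%R, +oo[) (w x * (t < x)%R%:R)%:E + a%:E.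
    rewrite -aE -cE -ge0_integralD//; last 4 first.
    - by move=> x _; rewrite lee_fin mulr_ge0.
    - by apply: measurable_funTS; exact/measurable_EFinP.
    - by move=> x _; rewrite lee_fin mulr_ge0.
    - by apply: measurable_funTS; exact/measurable_EFinP.
    apply: eq_integral => x _; rewrite -EFinD -mulrDr; congr EFin.
    by case: ltP => _; rewrite ?addr0 ?add0r mulr1.
  by move=> cE'; rewrite EFinB cE' addeK.
have wprod n' : measurable_fun [set: Rn R n'] (fun x : Rn R n' => \prod_(i < n') w (tnth x i))%R.
  rewrite (_ : (fun x => _) = (fun x : Rn R n' => \prod_(i <- enum 'I_n') w (tnth x i))%R); last first.
    by apply/funext => x; rewrite big_enum.
  apply: measurable_prod => i _; apply: (measurableT_comp mw).
  exact: measurable_tnth_Rn.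
have mex n' m' : measurable_fun [set: Rn R n'] (fun x : Rn R n' => (m' <= exceed t x)%N%:R : R).
  apply: measurable_fun_natr_bool.
  apply: (@measurableT_comp _ _ _ _ _ _ (fun z : R * Rn R n' => (m' <= exceed z.1 z.2)%N)
    _ (fun x => (t, x))).
    exact: measurable_exceed.
  exact: measurable_fun_pair.
have Zr (f : R -> R) (k : \bar R) : measurable_fun [set: R] f ->
    (forall x, 0 <= f x)%R -> 0 <= k ->
    \int[mu]_(x in `]0%R, +oo[) ((f x)%:E * k) =
    \int[mu]_(x in `]0%R, +oo[) (f x)%:E * k.
  move=> mf f0 k0; apply: ge0_integralZr => //; last by move=> x _; rewrite lee_fin.
  by apply: measurable_funTS; exact/measurable_EFinP.
elim: n m => [|n IH] m.
  rewrite /= big_ord0 /exceed big_ord0 expr0 !mul1r; case: m => [|m]//.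
(* One statement for all branches: [m''] is the number of exceedances still required from the other
   coordinates once x is known. *)
have step x m' m'' : (0 < x)%R -> (forall y : Rn R n,
    (m' <= (t < `|x|)%R + exceed t y)%N = (m'' <= exceed t y)%N) ->
  iter_int n (fun y => (\prod_(i < n.+1) w (tnth (cons_Rn R n (x, y)) i) *
     (m' <= exceed t (cons_Rn R n (x, y)))%N%:R)%:E) =
  (w x)%:E * (c ^+ n * tail_prob (a / c) n m'')%:E.
  move=> x0 H; rewrite -IH -iter_intZl; last 3 first.
  - by apply/measurable_EFinP; apply: measurable_funM; [exact: wprod|exact: mex].
  - by move=> y; rewrite lee_fin mulr_ge0// prodr_ge0.
  - by rewrite lee_fin.
  apply: eq_iter_int => y _; rewrite exceed_cons H big_ord_recl tnth0.
  rewrite -EFinM -!mulrA; congr (_ * (_ * _))%:E.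
  by apply: eq_bigr => i _; rewrite tnthS.
case: m => [|m].
  transitivity (\int[mu]_(x in `]0%R, +oo[) ((w x)%:E * (c ^+ n * tail_prob (a / c) n 0)%:E)).
    apply: eq_integral => x x0'; apply: step => //.
    by move: x0'; rewrite inE/= in_itv/= andbT.
  rewrite Zr//; last by rewrite lee_fin tail_prob0 mulr1 exprn_ge0// ltW.
  by rewrite cE -EFinM !tail_prob0 !mulr1 exprS.
have Q0 k : 0 <= (c ^+ n * tail_prob (a / c) n k)%:E.
  by rewrite -IH; apply: iter_int_ge0 => x; rewrite lee_fin mulr_ge0// prodr_ge0.
transitivity (\int[mu]_(x in `]0%R, +oo[) (
    (w x * (t < x)%R%:R)%:E * (c ^+ n * tail_prob (a / c) n m)%:E +
    (w x * (x <= t)%R%:R)%:E * (c ^+ n * tail_prob (a / c) n m.+1)%:E)).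
  apply: eq_integral => x x0'.
  have x0 : (0 < x)%R by move: x0'; rewrite inE/= in_itv/= andbT.
  have [xt|xt] := ltP t x.
    rewrite mulr1 mulr0 mul0e adde0; apply: step => // y.
    by rewrite gtr0_norm// xt.
  rewrite mulr1 mulr0 mul0e add0e; apply: step => // y.
  by rewrite gtr0_norm// ltNge xt.
rewrite ge0_integralD; last 5 first.
- by [].
- by move=> x _; rewrite mule_ge0// lee_fin mulr_ge0.
- apply: measurable_funTS; apply: emeasurable_funM => //; exact/measurable_EFinP.
- by move=> x _; rewrite mule_ge0// lee_fin mulr_ge0.
- apply: measurable_funTS; apply: emeasurable_funM => //; exact/measurable_EFinP.
rewrite !Zr//; try by move=> x; rewrite mulr_ge0.
rewrite aE bE -!EFinM -EFinD; congr EFin; rewrite exprS /=; field.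
by rewrite gt_eqF.
Qed.

End tail_prob.

(** * The Gamma function *)

Section gamma.
Context {R : realType}.
Local Notation mu := (@lebesgue_measure R).
Local Open Scope ereal_scope.

(** [Gamma] is the finite part of this extended-real integral; identities are proved here, before
    finiteness is known. *)
Definition gam (z : R) : \bar R :=
  \int[mu]_(t in `]0%R, +oo[) (t `^ (z - 1) * expR (- t))%:E.

Let mpowR (a : R) : measurable_fun [set: R] (fun t => t `^ a)%R.
Proof. exact: measurable_fun_powR. Qed.

Let mexp : measurable_fun [set: R] (fun t => expR (- t))%R.
Proof. by apply: measurableT_comp => //; exact: measurable_expR. Qed.

Lemma gam_ge0 (z : R) : 0 <= gam z.
Proof. by apply: integral_ge0 => t _; rewrite lee_fin mulr_ge0 ?powR_ge0 ?expR_ge0. Qed.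

(** In place of integration by parts, t^z is written as the integral of z s^(z-1) over (0, t) and
    the order is exchanged by Tonelli; the integral of exp(-t) over t > s is exp(-s). *)
Lemma gamS (z : R) : (0 < z)%R -> gam (z + 1) = z%:E * gam z.
Proof.
move=> z0; pose f (u : measurableTypeR R * measurableTypeR R) : R :=
  (z * u.2 `^ (z - 1) * (u.2 < u.1)%R%:R * expR (- u.1))%R.
have f0 u : (0 <= f u)%R by rewrite !mulr_ge0 ?powR_ge0 ?expR_ge0 ?(ltW z0).
have mf : measurable_fun [set: _] f.
  apply: measurable_funM; last exact: (measurableT_comp mexp).
  apply: measurable_funM; last first.
    by apply: measurable_fun_natr_bool; exact: measurable_fun_ltr.
  by apply: measurable_funM => //; exact: measurable_fun_powR.
transitivity (\int[mu]_(t in `]0%R, +oo[) \int[mu]_(s in `]0%R, +oo[) (f (t, s))%:E).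
  apply: eq_integral => t; rewrite inE/= in_itv/= andbT => t0.
  rewrite addrK EFinM -(integral_powR _ _ z0 (ltW t0)) -ge0_integralZr; last 4 first.
  - by [].
  - apply: measurable_funTS; apply/measurable_EFinP; exact: measurable_funM.
  - by move=> s _; rewrite lee_fin mulr_ge0 ?powR_ge0 ?(ltW z0).
  - by rewrite lee_fin expR_ge0.
  rewrite [LHS]integral_mkcond [RHS]integral_mkcond; apply: eq_integral => s _.
  rewrite !patchE !mem_setE /= !in_itv/= andbT /f/=.
  by case: ltP => s0 //=; case: ltP => st; rewrite ?mulr1 -?EFinM// mulr0 mul0r.
rewrite (tonelli_on _ _ _ _ _ mu mu _ _ (fun u => (f u)%:E))//; last exact/measurable_EFinP.
rewrite -ge0_integralZl; last 4 first.
- by [].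
- by apply: measurable_funTS; apply/measurable_EFinP; exact: measurable_funM.
- by move=> t _; rewrite lee_fin mulr_ge0 ?powR_ge0 ?expR_ge0.
- by rewrite lee_fin ltW.
apply: eq_integral => s; rewrite inE/= in_itv/= andbT => s0.
rewrite EFinM muleA -(integral_expRN_tail s s0) -integral_itv_obnd_cbnd; last first.
  by apply: measurable_funTS; exact/measurable_EFinP.
rewrite -EFinM -ge0_integralZl; last 4 first.
- by [].
- by apply: measurable_funTS; exact/measurable_EFinP.
- by move=> t _; rewrite lee_fin expR_ge0.
- by rewrite lee_fin mulr_ge0 ?powR_ge0 ?(ltW z0).
rewrite [LHS]integral_mkcond [RHS]integral_mkcond; apply: eq_integral => t _.
rewrite !patchE !mem_setE /= !in_itv/= !andbT /f/=.
have [st|st] := ltP s t; first by rewrite (lt_trans s0 st) mulr1 EFinM.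
by rewrite mulr0 mul0r if_same.
Qed.

Lemma integral_powR1 (z t : R) : (0 < z)%R -> (0 <= t)%R ->
  \int[mu]_(x in `]0%R, t[) (x `^ (z - 1))%:E = (t `^ z / z)%:E.
Proof.
move=> z0 t0; rewrite EFinM -(integral_powR _ _ z0 t0) -ge0_integralZr; last 4 first.
- by [].
- by apply: measurable_funTS; apply/measurable_EFinP; exact: measurable_funM.
- by move=> s _; rewrite lee_fin mulr_ge0 ?powR_ge0 ?(ltW z0).
- by rewrite lee_fin invr_ge0 ltW.
by apply: eq_integral => s _; rewrite -EFinM mulrAC mulfV ?mul1r ?gt_eqF.
Qed.

Lemma integral_split_at1 (f : R -> R) : measurable_fun [set: R] f -> (forall x, 0 <= f x)%R ->
  \int[mu]_(t in `]0%R, +oo[) (f t)%:E =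
  \int[mu]_(t in `]0%R, 1%R[) (f t)%:E + \int[mu]_(t in `[1%R, +oo[) (f t)%:E.
Proof.
move=> mf f0.
rewrite -ge0_integral_setU//.
- congr integral; apply/seteqP; split=> t /=; rewrite !in_itv/= ?andbT.
    by move=> t0; case: (ltP t 1%R) => t1; [left; rewrite t0|right].
  by case=> [/andP[]//|]; exact: lt_le_trans.
- by apply: measurable_funTS; exact/measurable_EFinP.
- by move=> t _; rewrite lee_fin.
- apply/disj_setPS => t /= []; rewrite !in_itv/= andbT => /andP[_ t1].
  by rewrite leNgt t1.
Qed.

(** Use exp(-t) <= 1 on (0, 1) and t^(z-1) <= 1 beyond. At z = 1/n this bounds Gamma(1/n) by n +
    1. *)
Lemma gam_le (z : R) : (0 < z)%R -> (z <= 1)%R -> gam z <= (z^-1 + 1)%:E.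
Proof.
move=> z0 z1; rewrite /gam integral_split_at1; last 2 first.
- exact: measurable_funM.
- by move=> t; rewrite mulr_ge0 ?powR_ge0 ?expR_ge0.
rewrite EFinD; apply: leeD.
  apply: (@le_trans _ _ (\int[mu]_(t in `]0%R, 1%R[) (t `^ (z - 1))%:E)); last first.
    by rewrite integral_powR1// powR1 mul1r.
  apply: ge0_le_integral => //.
  - by move=> t _; rewrite lee_fin mulr_ge0 ?powR_ge0 ?expR_ge0.
  - by apply: measurable_funTS; apply/measurable_EFinP; exact: measurable_funM.
  - by apply: measurable_funTS; exact/measurable_EFinP.
  - move=> t; rewrite /= in_itv/= => /andP[t0 _].
    by rewrite lee_fin ler_piMr ?powR_ge0// expR_le1 oppr_le0 ltW.
apply: (@le_trans _ _ (\int[mu]_(t in `[1%R, +oo[) (expR (- t))%:E)); last first.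
  by rewrite integral_expRN_tail// lee_fin expR_le1 oppr_le0.
apply: ge0_le_integral => //.
- by move=> t _; rewrite lee_fin mulr_ge0 ?powR_ge0 ?expR_ge0.
- by apply: measurable_funTS; apply/measurable_EFinP; exact: measurable_funM.
- by apply: measurable_funTS; exact/measurable_EFinP.
- move=> t; rewrite /= in_itv/= andbT => t1.
  by rewrite lee_fin ler_piMl ?expR_ge0// -[leRHS](powRr0 t) ler_powR// subr_le0.
Qed.

(** From exp(-t) >= 1 - t on (0, 1), with the negative term moved to the right so that all
    integrands are nonnegative. At z = 1/n it gives Gamma(1/n) >= n^2 / (n + 1). *)
Lemma le_gam (z : R) : (0 < z)%R -> (z^-1)%:E <= gam z + ((z + 1)^-1)%:E.
Proof.
move=> z0; have -> : (z^-1)%:E = \int[mu]_(x in `]0%R, 1%R[) (x `^ (z - 1))%:E :> \bar R.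
  by rewrite integral_powR1// powR1 mul1r.
have -> : ((z + 1)^-1)%:E = \int[mu]_(x in `]0%R, 1%R[) (x `^ z)%:E :> \bar R.
  have := integral_powR1 (z + 1) 1%R (addr_gt0 z0 ltr01) ler01.
  by rewrite addrK powR1 mul1r => ->.
apply: (@le_trans _ _ (\int[mu]_(t in `]0%R, 1%R[) (t `^ (z - 1) * expR (- t))%:E +
   \int[mu]_(x in `]0%R, 1%R[) (x `^ z)%:E)).
  rewrite -ge0_integralD; last 5 first.
  - by [].
  - by move=> t _; rewrite lee_fin mulr_ge0 ?powR_ge0 ?expR_ge0.
  - by apply: measurable_funTS; apply/measurable_EFinP; exact: measurable_funM.
  - by move=> t _; rewrite lee_fin powR_ge0.
  - by apply: measurable_funTS; exact/measurable_EFinP.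
  apply: ge0_le_integral => //.
  - by move=> t _; rewrite lee_fin powR_ge0.
  - by apply: measurable_funTS; exact/measurable_EFinP.
  - apply: measurable_funTS; apply: emeasurable_funD; apply/measurable_EFinP => //.
    exact: measurable_funM.
  - move=> t; rewrite /= in_itv/= => /andP[t0 _]; rewrite -EFinD lee_fin.
    have -> : (t `^ z = t * t `^ (z - 1))%R by rewrite mulr_powRB1// ltW.
    rewrite (mulrC _ (expR _)) -mulrDl ler_peMl ?powR_ge0//.
    by rewrite -lerBlDr; apply: le_trans (expR_ge1Dx _).
apply: leeD => //; apply: ge0_subset_integral => //.
- by apply: measurable_funTS; apply/measurable_EFinP; exact: measurable_funM.
- by move=> t _; rewrite lee_fin mulr_ge0 ?powR_ge0 ?expR_ge0.
- by move=> t /=; rewrite !in_itv/= andbT => /andP[].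
Qed.

(** The two preceding bounds settle (0, 1], and the functional equation carries the claim upwards
    one unit at a time. *)
Lemma gam_fin (z : R) : (0 < z)%R -> exists2 g : R, (0 < g)%R & gam z = g%:E.
Proof.
have H (k : nat) : forall z : R, (0 < z <= k.+1%:R)%R -> exists2 g : R, (0 < g)%R & gam z = g%:E.
  elim: k => [|k IH] {}z /andP[z0 zk].
    have := gam_le _ z0 zk; have := gam_ge0 z; have := le_gam _ z0.
    case: (gam z) => [g| |]//= + _ _; rewrite lee_fin => gz.
    exists g => //; rewrite -(ltrD2r ((z + 1)^-1)) add0r; apply: lt_le_trans gz.
    by rewrite ltf_pV2 ?posrE ?ltrDl// addr_gt0.
  have [z1|z1] := leP z 1%R.
    by apply: IH; rewrite z0 (le_trans z1)// ler1n.
  have z10 : (0 < z - 1)%R by rewrite subr_gt0.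
  have [|g g0 gE] := IH (z - 1)%R.
    by rewrite z10 lerBlDr natr1.
  exists ((z - 1) * g)%R; first exact: mulr_gt0.
  by rewrite -[in LHS](subrK 1%R z) gamS// gE.
move=> z0; apply: (H (Num.truncn z)); rewrite z0/=.
exact/ltW/truncnS_gt.
Qed.

Lemma GammaE (z : R) : (0 < z)%R -> (Gamma z)%:E = gam z.
Proof.
move=> z0; rewrite /Gamma /Rintegral -/(gam z).
by have [g _ ->] := gam_fin _ z0.
Qed.

Lemma Gamma_gt0 (z : R) : (0 < z)%R -> (0 < Gamma z)%R.
Proof. by move=> z0; rewrite -lte_fin GammaE//; have [g g0 ->] := gam_fin _ z0. Qed.

Lemma GammaS (z : R) : (0 < z)%R -> Gamma (z + 1) = (z * Gamma z)%R.
Proof.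
move=> z0; apply: EFin_inj; rewrite EFinM !GammaE//; first exact: gamS.
by rewrite addr_gt0.
Qed.

Lemma integral_powR_expR (p a : R) : (0 < p)%R -> (0 < a)%R ->
  \int[mu]_(x in `]0%R, +oo[) (x `^ (p * a - 1) * expR (- x `^ p))%:E = (Gamma a / p)%:E.
Proof.
move=> p0 a0; rewrite EFinM GammaE//.
have -> : gam a = \int[mu]_(u in `]0%R, +oo[)
    ((p * u `^ (p - 1))%:E * ((u `^ p) `^ (a - 1) * expR (- u `^ p))%:E).
  apply/esym/(integral_powR_subst p (fun t => (t `^ (a - 1) * expR (- t))%:E)) => //.
    by apply/measurable_EFinP; exact: measurable_funM.
  by move=> x; rewrite lee_fin mulr_ge0 ?powR_ge0 ?expR_ge0.
rewrite -ge0_integralZr; last 4 first.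
- by [].
- apply: measurable_funTS; apply: emeasurable_funM; apply/measurable_EFinP.
    exact: measurable_funM.
  apply: measurable_funM; first by apply: measurable_fun_powR.
  exact: (measurableT_comp mexp (mpowR p)).
- by move=> x _; rewrite mule_ge0// lee_fin !mulr_ge0 ?powR_ge0 ?expR_ge0 ?(ltW p0).
- by rewrite lee_fin invr_ge0 ltW.
apply: eq_integral => x; rewrite inE/= in_itv/= andbT => x0.
rewrite -!EFinM; congr EFin.
rewrite -powRrM (_ : p * a - 1 = (p - 1) + p * (a - 1))%R; last by ring.
rewrite powRD; last by rewrite (gt_eqF x0) implybT.
by field; rewrite gt_eqF.
Qed.

End gamma.

(** * Estimates *)

Section tail_prob_estimates.
Context {R : realType}.
Local Notation mu := (@lebesgue_measure R).

Lemma tail_prob_gt (y : R) n m : (n < m)%N -> tail_prob y n m = 0.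
Proof.
elim: n m => [|n IH] [|m]//= nm.
by rewrite !IH ?mulr0 ?addr0// ltnW.
Qed.

Lemma tail_prob_ge0 (y : R) n m : 0 <= y <= 1 -> 0 <= tail_prob y n m.
Proof.
move=> /andP[y0 y1]; elim: n m => [|n IH] [|m]//=.
by rewrite addr_ge0// mulr_ge0// subr_ge0.
Qed.

Lemma tail_probS (y : R) n m : 0 <= y <= 1 -> tail_prob y n m.+1 <= tail_prob y n m.
Proof.
move=> /andP[y0 y1]; elim: n m => [|n IH] [|m]//=; last first.
  by rewrite lerD// ler_wpM2l// subr_ge0.
have := IH 0%N; rewrite tail_prob0 => h.
by rewrite mulr1 addrC -lerBrDr opprB addrC subrK ler_piMr.
Qed.

(** Altering only the probability of the first event changes the value by (z - y)(c - d), where c >=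
    d because fewer occurrences are easier to reach; the induction hypothesis treats the other
    events. *)
Lemma le_tail_prob (y z : R) n m : 0 <= y -> y <= z -> z <= 1 ->
  tail_prob z n m <= tail_prob y n m.
Proof.
move=> y0 yz z1; have y01 : 0 <= y <= 1 by rewrite y0 (le_trans yz).
have z01 : 0 <= z <= 1 by rewrite z1 (le_trans y0).
elim: n m => [|n IH] [|m]//=.
have := tail_probS y n m y01; have := IH m; have := IH m.+1.
have := tail_prob_ge0 z n m z01; have := tail_prob_ge0 z n m.+1 z01.
move: (tail_prob z n m) (tail_prob z n m.+1) (tail_prob y n m) (tail_prob y n m.+1).
move=> a b c d b0 a0 bd ac dc.
apply: (@le_trans _ _ ((1 - z) * c + z * d)).
  by rewrite lerD// ler_wpM2l// ?subr_ge0// (le_trans y0).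
rewrite -subr_ge0.
have -> : (1 - y) * c + y * d - ((1 - z) * c + z * d) = (z - y) * (c - d) by ring.
by rewrite mulr_ge0// subr_ge0.
Qed.

(** The union bound over m-subsets: once the factor y <= 1 is dropped, the recursion of [tail_prob]
    is dominated by Pascal's rule. *)
Lemma tail_prob_le_bin (y : R) n m : 0 <= y <= 1 ->
  tail_prob y n m <= 'C(n, m)%:R * (1 - y) ^+ m.
Proof.
move=> /andP[y0 y1]; have y1' : 0 <= 1 - y by rewrite subr_ge0.
elim: n m => [|n IH] [|m]//=; rewrite ?bin0 ?expr0 ?mulr1 ?bin0n ?mul0r//.
rewrite binS natrD [leRHS]mulrDl [leLHS]addrC lerD//.
  apply: (le_trans (ler_wpM2l y0 (IH m.+1))).
  by rewrite ler_piMl// mulr_ge0// exprn_ge0.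
by rewrite exprS mulrCA ler_wpM2l.
Qed.

Lemma measurable_tail_prob d (T : measurableType d) (f : T -> R) n m :
  measurable_fun [set: T] f -> measurable_fun [set: T] (fun x => tail_prob (f x) n m).
Proof.
move=> mf; elim: n m => [|n IH] [|m]//=.
by apply: measurable_funD; apply: measurable_funM => //; exact: measurable_funB.
Qed.

(* Mean of U^a for U the m-th largest of n independent uniform variables
   on [0, 1]; it vanishes for m > n because of the factor i = n. *)
Definition order_moment (a : R) n m : R :=
  \prod_(i < m) ((n%:R - i%:R) / (a + n%:R - i%:R)).

(** This is the recursion of [tail_prob] integrated against a y^(a-1) on (0, 1): a further factor y
    raises [a] by one and costs a / (a + 1). The subtracted term stands on the left. *)
Lemma order_momentS (a : R) n m : 0 < a -> (m <= n)%N ->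
  order_moment a n.+1 m.+1 + a / (a + 1) * order_moment (a + 1) n m =
  order_moment a n m + a / (a + 1) * order_moment (a + 1) n m.+1.
Proof.
move=> a0 mn; rewrite /order_moment.
have D0 i : (i <= n)%N -> a + n%:R - i%:R != 0.
  by move=> i_n; rewrite -addrA gt_eqF// ltr_wpDr// subr_ge0 ler_nat.
pose A := \prod_(i < m) (n%:R - i%:R : R).
pose B := \prod_(i < m) (a + n%:R - i%:R).
pose B1 := \prod_(i < m) (a + 1 + n%:R - i%:R).
have n1 : n.+1%:R = n%:R + 1 :> R by rewrite natr1.
have AS : \prod_(i < m.+1) (n.+1%:R - i%:R : R) = (n%:R + 1) * A.
  rewrite big_ord_recl subr0 n1; congr (_ * _); apply: eq_bigr => i _.
  by rewrite lift0 -(natr1 i); ring.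
have BS : \prod_(i < m.+1) (a + n.+1%:R - i%:R) = (a + n%:R + 1) * B.
  rewrite big_ord_recl subr0 n1 addrA; congr (_ * _); apply: eq_bigr => i _.
  by rewrite lift0 -(natr1 i); ring.
(* Raising a by one shifts the window of consecutive factors by one place, so [B1] and [B] differ in
   their two end factors only. *)
have B1S : (a + n%:R + 1) * B = B1 * (a + 1 + n%:R - m%:R).
  rewrite -BS big_ord_recr/= n1; congr (_ * _); last by ring.
  by apply: eq_bigr => i _; ring.
have B0 : B != 0.
  by apply/prodf_neq0 => i _; apply: D0; rewrite (leq_trans _ mn)// ltnW.
have h : a + 1 + n%:R - m%:R != 0.
  by have := D0 _ mn; rewrite !gt_eqF// -addrA ltr_wpDr ?subr_ge0 ?ler_nat// addr_gt0.
have B1E : B1 = (a + n%:R + 1) * B / (a + 1 + n%:R - m%:R) by rewrite B1S mulfK.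
rewrite !prodf_div AS BS -/A -/B -/B1 !big_ord_recr/= -/A -/B1 B1E.
have h2 : a + n%:R + 1 != 0.
  by rewrite gt_eqF// -addrA ltr_wpDr// addr_ge0.
have h3 : a + 1 != 0 by rewrite gt_eqF// addr_gt0.
field.
by rewrite h h2 h3 B0.
Qed.

End tail_prob_estimates.

(** * Moments of uniform order statistics *)

Section tail_prob_integral.
Context {R : realType}.
Local Notation mu := (@lebesgue_measure R).
Local Open Scope ereal_scope.

(** [tail_prob y n m] is the probability that the m-th largest of n uniform variables exceeds y, so
    the left side is the layer-cake form of its a-th moment. The induction on n keeps [a] general
    because conditioning raises it by one. *)
Lemma integral_tail_prob (a : R) n m : (0 < a)%R ->
  \int[mu]_(y in `]0%R, 1%R[) (tail_prob y n m * (a * y `^ (a - 1)))%:E =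
  (order_moment a n m)%:E.
Proof.
elim: n m a => [|n IH] m a a0.
  case: m => [|m].
    rewrite /order_moment big_ord0 -[RHS](congr1 EFin (congr1 (fun h => h a) (powR1 R))).
    rewrite -integral_powR//; apply: eq_integral => y _ /=.
    by rewrite mul1r.
  rewrite /order_moment big_ord_recl subrr !mul0r integral0_eq// => y _.
  by rewrite mul0r.
case: m => [|m].
  rewrite /order_moment big_ord0 -[RHS](congr1 EFin (congr1 (fun h => h a) (powR1 R))).
  rewrite -integral_powR//; apply: eq_integral => y _ /=.
  by rewrite mul1r.
have [mn|nm] := leqP m n; last first.
  rewrite integral0_eq; last by move=> y _; rewrite tail_prob_gt// mul0r.
  have nm' : (n.+1 < m.+1)%N by [].
  by rewrite /order_moment (bigD1 (Ordinal nm'))//= subrr !mul0r.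
have mT k (b c : R) : measurable_fun [set: R] (fun y => tail_prob y k.1 k.2 * (b * y `^ c))%R.
  apply: measurable_funM; first exact: measurable_tail_prob.
  by apply: measurable_funM => //; exact: measurable_fun_powR.
have mT' k (b c : R) : measurable_fun (`]0%R, 1%R[%classic : set (measurableTypeR R))
    (fun y : measurableTypeR R => (tail_prob y k.1 k.2 * (b * y `^ c))%:E).
  by apply: measurable_funTS; apply/measurable_EFinP; exact: mT.
have T0 k (b c : R) (y : R) : (0 < b)%R -> `]0%R, 1%R[%classic y ->
    0 <= (tail_prob y k.1 k.2 * (b * y `^ c))%:E.
  move=> b0; rewrite /= in_itv/= => /andP[y0 y1].
  by rewrite lee_fin !mulr_ge0 ?powR_ge0 ?(ltW b0)// tail_prob_ge0// !ltW.
have a10 : (0 < a + 1)%R by rewrite addr_gt0.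
have IH2 k : \int[mu]_(y in `]0%R, 1%R[) (tail_prob y n k * (a * y `^ a))%:E =
    (a / (a + 1) * order_moment (a + 1) n k)%:E.
  rewrite EFinM -IH// -ge0_integralZl; last 4 first.
  - by [].
  - exact: (mT' (n, k)).
  - by move=> y y01; exact: (T0 (n, k)).
  - by rewrite lee_fin divr_ge0// ltW.
  apply: eq_integral => y _; rewrite -EFinM addrK; congr EFin; field.
  by rewrite gt_eqF.
(* Every term sits on the side where it is nonnegative; the finite one is cancelled at the end. *)
have : \int[mu]_(y in `]0%R, 1%R[) (tail_prob y n.+1 m.+1 * (a * y `^ (a - 1)))%:E +
    (a / (a + 1) * order_moment (a + 1) n m)%:E =
    (order_moment a n m + a / (a + 1) * order_moment (a + 1) n m.+1)%:E.
  rewrite EFinD -IH// -!IH2 -ge0_integralD; last 5 first.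
  - by [].
  - by move=> y y01; exact: (T0 (n.+1, m.+1)).
  - exact: (mT' (n.+1, m.+1)).
  - by move=> y y01; exact: (T0 (n, m)).
  - exact: (mT' (n, m)).
  rewrite -ge0_integralD; last 5 first.
  - by [].
  - by move=> y y01; exact: (T0 (n, m)).
  - exact: (mT' (n, m)).
  - by move=> y y01; exact: (T0 (n, m.+1)).
  - exact: (mT' (n, m.+1)).
  apply: eq_integral => y; rewrite inE/= in_itv/= => /andP[y0 _].
  rewrite -!EFinD; congr EFin.
  by rewrite -(mulr_powRB1 (ltW y0) a0); ring.
rewrite -order_momentS// EFinD => /(congr1 (fun z => z - (a / (a + 1) * order_moment (a + 1) n m)%:E)).
by rewrite !addeK.
Qed.

(** The substitution t = c y^a: this is the mean of c U^a for the order statistic U. *)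
Lemma integral_tail_prob_powR (c a : R) n m : (0 < c)%R -> (0 < a)%R ->
  \int[mu]_(t in `]0%R, c[) (tail_prob ((t / c) `^ a^-1) n m)%:E =
  (c * order_moment a n m)%:E.
Proof.
move=> c0 a0.
(* The absolute value only serves to make g nonnegative for t > 1. *)
pose g (t : R) := (`|tail_prob (t `^ a^-1) n m| * (t < 1)%R%:R)%R.
have mg : measurable_fun [set: R] g.
  apply: measurable_funM.
    apply: measurableT_comp => //; apply: measurable_tail_prob.
    exact: measurable_fun_powR.
  by apply: measurable_fun_natr_bool; exact: measurable_fun_ltr.
have g0 t : (0 <= g t)%R by rewrite mulr_ge0.
have gE t : (0 < t)%R -> (t < 1)%R -> g t = tail_prob (t `^ a^-1) n m.
  move=> t0 t1; rewrite /g t1 mulr1 ger0_norm// tail_prob_ge0// powR_ge0/=.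
  by rewrite -(powRr0 t) ger_powR ?t0 ?(ltW t1)// invr_ge0 ltW.
transitivity (\int[mu]_(t in `]0%R, +oo[) (g (c^-1 * t)%R)%:E).
  rewrite [LHS]integral_mkcond [RHS]integral_mkcond; apply: eq_integral => t _.
  rewrite !patchE !mem_setE /= !in_itv/= andbT.
  case: (ltP 0%R t) => t0 //=; case: (ltP t c) => tc.
    by rewrite (mulrC c^-1%R) gE ?divr_gt0 ?ltr_pdivrMr ?mul1r.
  by rewrite /g (mulrC c^-1%R) ltr_pdivrMr// mul1r ltNge tc/= mulr0.
transitivity (c%:E * \int[mu]_(t in `]0%R, +oo[) ((c^-1)%:E * (g (c^-1 * t)%R)%:E)).
  rewrite -ge0_integralZl; last 4 first.
  - by [].
  - apply: measurable_funTS; apply: emeasurable_funM => //; apply/measurable_EFinP.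
    by apply: (measurableT_comp mg); exact: mulrl_measurable.
  - by move=> t _; rewrite mule_ge0// lee_fin// invr_ge0 ltW.
  - by rewrite lee_fin ltW.
  by apply: eq_integral => t _; rewrite -!EFinM mulrA mulfV ?mul1r ?gt_eqF.
rewrite (integral_scale _ (EFin \o g)) ?invr_gt0//; last 1 first.
- by apply/measurable_EFinP.
rewrite EFinM -integral_tail_prob//; congr (_ * _).
rewrite -(integral_powR_subst a (EFin \o g))//; last 1 first.
- by apply/measurable_EFinP.
rewrite [LHS]integral_mkcond [RHS]integral_mkcond; apply: eq_integral => y _.
rewrite !patchE !mem_setE /= !in_itv/= andbT.
case: (ltP 0%R y) => y0 //=.
have -> : (y < 1)%R = (y `^ a < 1)%R.
  have [y1|y1] := ltP y 1%R; apply/esym.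
    by have := gt0_ltr_powR a0 (ltW y0) ler01 y1; rewrite powR1.
  have := ge0_ler_powR (ltW a0) ler01 (ltW y0) y1.
  by rewrite powR1 => ya; rewrite ltNge ya.
case: ifP => y1; last by rewrite /g y1 mulr0 mule0.
rewrite gE// ?powR_gt0// -powRrM mulfV ?gt_eqF// powRr1 ?(ltW y0)//.
by rewrite -EFinM mulrC.
Qed.

End tail_prob_integral.

(** * The average error as an integral of tail probabilities *)

Section average_formula.
Context {R : realType}.
Local Notation mu := (@lebesgue_measure R).
Local Open Scope ereal_scope.

Lemma iter_int_prod (w : R -> R) (c : R) n : (0 < c)%R ->
  measurable_fun [set: R] w -> (forall x, 0 <= w x)%R ->
  \int[mu]_(x in `]0%R, +oo[) (w x)%:E = c%:E ->
  iter_int n (fun x => (\prod_(i < n) w (tnth x i))%:E) = (c ^+ n)%:E.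
Proof.
move=> c0 mw w0 cE.
have := @iter_int_tail _ w 0%R 0%R c n 0 (lexx _) c0 mw w0 cE.
rewrite tail_prob0 mulr1 => <-; first by apply: eq_iter_int => x _; rewrite mulr1.
apply: integral0_eq => x /=; rewrite in_itv/= andbT => x0.
by rewrite leNgt x0 mulr0.
Qed.

(** The polar formula expresses a known positive real as a product with the unknown integral [L];
    this forces [L] to be a positive real, which is how [l] and [c] are obtained. *)
Lemma mule_EFin_gt0 (L : \bar R) (u k v : R) : (0 < u)%R -> (0 < k)%R -> (0 < v)%R ->
  0 <= L -> v%:E = u%:E * (k%:E * L) -> exists2 l, (0 < l)%R & L = l%:E.
Proof.
move=> u0 k0 v0; case: L => [l| |]//; last by rewrite !gt0_muley ?lte_fin.
rewrite lee_fin -!EFinM => l0 -[vE]; exists l => //.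
rewrite lt_neqAle l0 andbT; apply/eqP => l0'.
by move: v0; rewrite vE -l0' !mulr0 ltxx.
Qed.

Lemma Gamma_div_gt0 (a c : R) : (0 < a)%R -> (0 < c)%R -> (0 < Gamma a / c)%R.
Proof. by move=> a0 c0; apply: divr_gt0 => //; exact: Gamma_gt0. Qed.

Variables (p : R) (k : nat).
Hypothesis p0 : (0 < p)%R.
Let n := k.+1.
Let b : R := (p / n%:R - 1)%R.

Definition weight (a : R) (x : R) : R := (x `^ a * expR (- x `^ p))%R.

Lemma weight_ge0 a x : (0 <= weight a x)%R.
Proof. by rewrite mulr_ge0 ?powR_ge0 ?expR_ge0. Qed.

Lemma measurable_weight a : measurable_fun [set: R] (weight a).
Proof.
apply: measurable_funM; first exact: measurable_fun_powR.
apply: (measurableT_comp (@measurable_expR R)); apply: measurableT_comp => //.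
Qed.

Lemma integral_weight (a : R) : (0 < a)%R ->
  \int[mu]_(x in `]0%R, +oo[) (weight (p * a - 1) x)%:E = (Gamma a / p)%:E.
Proof. exact: integral_powR_expR. Qed.

(** The polar formula for the extension of [f] homogeneous of degree [d], against exp(-|x|_p^p): the
    radial integral is that of s^(n-1+d) exp(-s^p). *)
Lemma iter_int_radial (f : Rn R n -> R) (d : R) : measurable_fun [set: Rn R n] f ->
  (forall x, 0 <= f x)%R -> (0 < n%:R + d)%R ->
  iter_int n (fun x => (f (radial p x) * weight d (pnorm p x))%:E) =
  n%:R%:E * ((Gamma ((n%:R + d) / p) / p)%:E *
    iter_int n (fun x => (f (radial p x) * (pnorm p x <= 1)%R%:R)%:E)).
Proof.
move=> mf f0 nd.
rewrite (ge0_polar k (fun x => f (radial p x)) (pnorm p) (weight d)); last 8 first.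
- by apply: measurableT_comp => //; exact: measurable_radial.
- exact: measurable_pnorm.
- exact: measurable_weight.
- by move=> x; exact: f0.
- by move=> x; exact: pnorm_ge0.
- by move=> x; exact: weight_ge0.
- by move=> x; exact: pnorm_gt0.
- move=> r x r0 x0; have ox : orthant n x by move=> i; exact: ltW.
  by rewrite radial_scale// pnorm_scale// ltW.
congr (_ * (_ * _)).
rewrite -integral_weight ?divr_gt0//; apply: eq_integral => s.
rewrite inE/= in_itv/= andbT => s0.
have -> : (p * ((n%:R + d) / p) - 1 = k%:R + d)%R.
  rewrite mulrC divfK ?gt_eqF// /n -natr1; ring.
rewrite /weight powRD; last by rewrite (gt_eqF s0) implybT.
by congr EFin; ring.
Qed.

(** The effect of the choice of beta: n + n b = p, so the radial Gamma factor is Gamma(1) for the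
    density and Gamma(1/p + 1) one degree higher, whatever n is. *)
Let nb (e : R) : (n%:R + (n%:R * b + e) = p + e)%R.
Proof.
by rewrite /b mulrBr mulr1 mulrCA mulfV ?pnatr_eq0// mulr1 addrA addrCA subrr addr0.
Qed.

Lemma prod_powR_radial (a : R) (x : Rn R n) : (forall i, 0 < tnth x i)%R ->
  (prod_powR a (radial p x) * pnorm p x `^ (n%:R * a) = prod_powR a x)%R.
Proof.
move=> x0; have ox : orthant n x by move=> i; exact: ltW.
have rx : (0 < pnorm p x)%R by exact: pnorm_gt0.
rewrite /prod_powR; under eq_bigr do rewrite tnth_mktuple powRM ?invr_ge0 ?(ltW rx)//.
rewrite big_split/= prodr_const card_ord mulrAC.
rewrite (mulrC n%:R a) powRrM powR_mulrn ?powR_ge0// -exprMn -powRM ?invr_ge0 ?(ltW rx)//.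
by rewrite mulVf ?gt_eqF// powR1 expr1n mul1r.
Qed.

Lemma prod_weight (x : Rn R n) :
  (prod_powR b x * expR (- pnorm p x `^ p) = \prod_(i < n) weight b (tnth x i))%R.
Proof. by rewrite big_split/= pnormX// -sumrN expR_sum. Qed.

(* After the substitution u = x^p this is the distribution function of
   Gamma(1/n), evaluated at t^p. *)
Definition coord_cdf (t : R) : R :=
  (fine (\int[mu]_(x in `]0%R, +oo[) (weight b x * (x <= t)%R%:R)%:E) /
   (Gamma n%:R^-1 / p))%R.

Let n0 : (0 < n%:R :> R)%R. Proof. by rewrite ltr0n. Qed.

Let W : R := (Gamma n%:R^-1 / p)%R.

Lemma total_weight : \int[mu]_(x in `]0%R, +oo[) (weight b x)%:E = W%:E.
Proof. by rewrite -integral_weight ?invr_gt0. Qed.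

Let W0 : (0 < W)%R.
Proof. by apply: Gamma_div_gt0 => //; rewrite invr_gt0. Qed.

Lemma measurable_weight_le (t : R) :
  measurable_fun [set: R] (fun x => weight b x * (x <= t)%R%:R)%R.
Proof.
apply: measurable_funM; first exact: measurable_weight.
by apply: measurable_fun_natr_bool; exact: measurable_fun_ler.
Qed.

Lemma coord_cdfE (t : R) : \int[mu]_(x in `]0%R, +oo[) (weight b x * (x <= t)%R%:R)%:E =
  (coord_cdf t * W)%:E.
Proof.
rewrite /coord_cdf -/W divfK ?gt_eqF// fineK// ge0_fin_numE; last first.
  by apply: integral_ge0 => x _; rewrite lee_fin mulr_ge0 ?weight_ge0.
apply: (@le_lt_trans _ _ W%:E); last by rewrite ltry.
rewrite -total_weight; apply: ge0_le_integral => //.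
- by move=> x _; rewrite lee_fin mulr_ge0 ?weight_ge0.
- by apply: measurable_funTS; apply/measurable_EFinP; exact: measurable_weight_le.
- by apply: measurable_funTS; apply/measurable_EFinP; exact: measurable_weight.
- by move=> x _; rewrite lee_fin ler_piMr ?weight_ge0// lern1; case: (x <= t)%R.
Qed.

Lemma avg_best_approxE m :
  avg_best_approx p +oo m (theta p b n) =
  (Gamma 1 / Gamma (p^-1 + 1))%:E *
  \int[mu]_(t in `]0%R, +oo[) (tail_prob (coord_cdf t) n m.+1)%:E.
Proof.
have G1 : (0 < Gamma 1 :> R)%R by exact: Gamma_gt0.
have Gp : (0 < Gamma (p^-1 + 1) :> R)%R by rewrite Gamma_gt0// addr_gt0 ?invr_gt0.
(* The volume: f = 1 and degree 0. *)
have [l l0 lE] : exists2 l, (0 < l)%R &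
    iter_int n (fun x : Rn R n => ((pnorm p x <= 1)%R%:R)%:E) = l%:E.
  have ip0 : (0 < p^-1)%R by rewrite invr_gt0.
  pose w0 x := expR (- x `^ p)%R.
  have w0E : \int[mu]_(x in `]0%R, +oo[) (w0 x)%:E = (Gamma p^-1 / p)%:E.
    rewrite -integral_weight ?invr_gt0//; apply: eq_integral => x _.
    by rewrite /weight mulfV ?gt_eqF// subrr powRr0 mul1r.
  have gp0 : (0 < Gamma p^-1 / p)%R by exact: Gamma_div_gt0 _ _ ip0 p0.
  have := iter_int_prod w0 _ n gp0 _ _ w0E.
  have mw0 : measurable_fun [set: R] w0.
    apply: (measurableT_comp (@measurable_expR R)); exact: measurableT_comp.
  move=> /(_ mw0 (fun x => expR_ge0 _)) H.
  have ball0 (x : Rn R n) : 0 <= (1 * (pnorm p x <= 1)%R%:R)%:E :> \bar R.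
    by rewrite lee_fin mul1r.
  have := iter_int_radial (fun=> 1%R) 0%R (measurable_cst _) (fun=> ler01).
  rewrite addr0 => /(_ n0).
  rewrite (_ : iter_int n (fun x => (1 * weight 0 (pnorm p x))%:E) =
               ((Gamma p^-1 / p) ^+ n)%:E); last first.
    rewrite -H; apply: eq_iter_int => x _; congr EFin.
    by rewrite mul1r /weight powRr0 mul1r pnormX// -sumrN expR_sum.
  move=> E0; have [l l0 lE] := mule_EFin_gt0 _ _ _ _ n0
    (Gamma_div_gt0 _ _ (divr_gt0 n0 p0) p0) (exprn_gt0 n gp0) (iter_int_ge0 _ _ ball0) E0.
  exists l => //; rewrite -lE.
  by apply: eq_iter_int => x _; rewrite mul1r.
have HW : iter_int n (fun x : Rn R n => (\prod_(i < n) weight b (tnth x i))%:E) = (W ^+ n)%:E.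
  apply: iter_int_prod => //; [exact: measurable_weight|exact: weight_ge0|exact: total_weight].
(* The density alone: degree n b. *)
have E1 : (W ^+ n)%:E = n%:R%:E * ((Gamma 1 / p)%:E *
    iter_int n (fun x => (prod_powR b (radial p x) * (pnorm p x <= 1)%R%:R)%:E)) :> \bar R.
  have := iter_int_radial (prod_powR b) (n%:R * b + 0) (measurable_prod_powR _ _) (prod_powR_ge0 _ _).
  rewrite nb addr0 mulfV ?gt_eqF// => /(_ p0) <-.
  rewrite -HW; apply: eq_iter_int => x x0; congr EFin.
  by rewrite /weight addr0 mulrA prod_powR_radial// prod_weight.
have [c c0 cE] : exists2 c, (0 < c)%R &
    iter_int n (fun x => (prod_powR b (radial p x) * (pnorm p x <= 1)%R%:R)%:E) = c%:E.
  apply: (mule_EFin_gt0 _ _ _ _ n0 (Gamma_div_gt0 _ _ ltr01 p0) (exprn_gt0 n W0) _ E1).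
  by apply: iter_int_ge0 => x; rewrite lee_fin mulr_ge0// prod_powR_ge0.
move: E1; rewrite cE -!EFinM => -[E1].
pose s (x : Rn R n) : R := best_approx +oo m x.
have ms : measurable_fun [set: Rn R n] s by exact: measurable_best_approx.
have s0 x : (0 <= s x)%R by exact: best_approx_ge0.
rewrite /avg_best_approx (integral_theta p p0 n _ b l c)//.
(* The density times the error: degree n b + 1, since the error is homogeneous of degree 1. *)
have E2 : iter_int n (fun x : Rn R n => (\prod_(i < n) weight b (tnth x i) * s x)%:E) =
    n%:R%:E * ((Gamma (p^-1 + 1) / p)%:E *
    iter_int n (fun x => (prod_powR b (radial p x) * s (radial p x) * (pnorm p x <= 1)%R%:R)%:E)).
  have := iter_int_radial (fun x => prod_powR b x * s x)%R (n%:R * b + 1)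
    (measurable_funM (measurable_prod_powR _ _) ms) (fun x => mulr_ge0 (prod_powR_ge0 _ _ _) (s0 _)).
  rewrite nb mulrDl mulfV ?gt_eqF// div1r (addrC 1%R) => <-; last by rewrite addr_gt0.
  apply: eq_iter_int => x x0; congr EFin.
  have rx : (0 < pnorm p x)%R by exact: pnorm_gt0.
  have sx : s x = (pnorm p x * s (radial p x))%R.
    by rewrite /s -best_approx_scale// radialK.
  rewrite -prod_weight -prod_powR_radial// sx.
  rewrite /weight powRD; last by rewrite (gt_eqF rx) implybT.
  rewrite powRr1 ?(ltW rx)//; ring.
(* The same integral in product form: the layer-cake formula, then the count of exceedances at each
   level t. *)
have E3 : iter_int n (fun x : Rn R n => (\prod_(i < n) weight b (tnth x i) * s x)%:E) =
  (W ^+ n)%:E * \int[mu]_(t in `]0%R, +oo[) (tail_prob (coord_cdf t) n m.+1)%:E.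
  pose g (z : measurableTypeR R * Rn R n) : R :=
    (\prod_(i < n) weight b (tnth z.2 i) * (m < exceed z.1 z.2)%N%:R)%R.
  have g0 z : (0 <= g z)%R by rewrite mulr_ge0// prodr_ge0// => i _; exact: weight_ge0.
  have mg : measurable_fun [set: _] g.
    apply: measurable_funM; last by apply: measurable_fun_natr_bool; exact: measurable_exceed.
    rewrite (_ : (fun z => _) = (fun z : measurableTypeR R * Rn R n =>
      \prod_(i <- enum 'I_n) weight b (tnth z.2 i))%R); last first.
      by apply/funext => z; rewrite big_enum.
    apply: measurable_prod => i _; apply: (measurableT_comp (measurable_weight b)).
    apply: (@measurableT_comp _ _ _ _ _ _ (fun x : Rn R n => tnth x i)) => //.
    exact: (@measurable_tnth _ (measurableTypeR R)).
  have TE t : (0 < t)%R -> iter_int n (fun x => (g (t, x))%:E) =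
      (W ^+ n * tail_prob (coord_cdf t) n m.+1)%:E.
    move=> t0; have := iter_int_tail (weight b) t (coord_cdf t * W) W n m.+1 (ltW t0) W0
      (measurable_weight b) (weight_ge0 b) total_weight (coord_cdfE t).
    by rewrite mulfK ?gt_eqF.
  transitivity (\int[mu]_(t in `]0%R, +oo[) iter_int n (fun x => (g (t, x))%:E)).
    rewrite (iter_int_swap n _ _ mu _ (fun z => (g z)%:E))//; last exact/measurable_EFinP.
    apply: eq_iter_int => x _; rewrite EFinM best_approx_layer.
    rewrite -ge0_integralZl; last 4 first.
    - by [].
    - apply: measurable_funTS; apply/measurable_EFinP; apply: measurable_fun_natr_bool.
      apply: (@measurableT_comp _ _ _ _ _ _ (fun z : measurableTypeR R * Rn R n => (m < exceed z.1 z.2)%N)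
        _ (fun t => (t, x))); first exact: measurable_exceed.
      exact: measurable_fun_pair.
    - by move=> t _; rewrite lee_fin.
    - by rewrite lee_fin prodr_ge0// => i _; exact: weight_ge0.
    by apply: eq_integral => t _; rewrite -EFinM.
  have Wn0 : (0 < W ^+ n)%R by exact: exprn_gt0.
  (* Dividing and multiplying by W^n lets the constant be pulled out on the strength of the
     measurability of the iterated integral in t. *)
  transitivity (\int[mu]_(t in `]0%R, +oo[) ((W ^+ n)%:E *
     ((W ^+ n)^-1%:E * iter_int n (fun x => (g (t, x))%:E)))).
    apply: eq_integral => t _; rewrite muleA -EFinM mulfV ?mul1e//.
    by rewrite gt_eqF.
  rewrite ge0_integralZl; last 4 first.
  - by [].
  - apply: measurable_funTS; apply: emeasurable_funM => //.
    apply: (measurable_fun_iter_int n _ _ (fun z => (g z)%:E)) => //.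
    exact/measurable_EFinP.
  - move=> t _; rewrite mule_ge0 ?lee_fin ?invr_ge0 ?(ltW Wn0)//.
    by apply: iter_int_ge0 => x; rewrite lee_fin.
  - by rewrite lee_fin ltW.
  congr (_ * _); apply: eq_integral => t t0'.
  have t0 : (0 < t)%R by move: t0'; rewrite inE/= in_itv/= andbT.
  rewrite TE// -EFinM; congr EFin.
  by rewrite mulrA mulVf ?mul1r// gt_eqF.
have K2 : (0 < Gamma (p^-1 + 1) / p :> R)%R := divr_gt0 Gp p0.
pose I := iter_int n (fun x : Rn R n =>
  (prod_powR b (radial p x) * s (radial p x) * (pnorm p x <= 1)%R%:R)%:E).
rewrite -/I in E2; rewrite -[iter_int n _]/I.
have -> : I = ((n%:R * (Gamma (p^-1 + 1) / p))^-1)%:E * (n%:R%:E * ((Gamma (p^-1 + 1) / p)%:E * I)).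
  rewrite (muleA n%:R%:E) -EFinM muleA -EFinM mulVf ?mul1e//.
  by rewrite gt_eqF// mulr_gt0.
rewrite -E2 E3 E1 !muleA -!EFinM; congr (_%:E * _); field.
by rewrite !gt_eqF.
Qed.

End average_formula.

(** * Bounds on the distribution function of one coordinate *)

Section estimates.
Context {R : realType}.
Local Notation mu := (@lebesgue_measure R).
Local Open Scope ereal_scope.
Variables (p : R) (k : nat).
Hypothesis p0 : (0 < p)%R.
Let n := k.+1.
Let a : R := (p / n%:R)%R.
Let G : R := Gamma n%:R^-1.

Let n0 : (0 < n%:R :> R)%R. Proof. by rewrite ltr0n. Qed.
Let a0 : (0 < a)%R. Proof. exact: divr_gt0. Qed.
Let G0 : (0 < G)%R. Proof. by apply: Gamma_gt0; rewrite invr_gt0. Qed.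

(** With [G_le] this pins Gamma(1/n)/n, that is Gamma(1 + 1/n), to 1 up to a factor 1 + 1/n. *)
Lemma le_Gamma_inv : (n%:R / (n%:R + 1) <= G / n%:R)%R.
Proof.
have inv0 : (0 < n%:R^-1 :> R)%R by rewrite invr_gt0.
have := le_gam _ inv0; rewrite -GammaE// -EFinD lee_fin invrK -/G => H.
rewrite ler_pdivlMr// -subr_ge0.
have -> : (G - n%:R / (n%:R + 1) * n%:R = G + (n%:R^-1 + 1)^-1 - n%:R)%R.
  field.
  by rewrite !gt_eqF ?addr_gt0.
by rewrite subr_ge0.
Qed.

Let G_le : (G / n%:R <= (n%:R + 1) / n%:R)%R.
Proof.
have inv0 : (0 < n%:R^-1 :> R)%R by rewrite invr_gt0.
rewrite ler_pM2r ?invr_gt0//.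
have inv1 : (n%:R^-1 <= 1 :> R)%R by rewrite invf_le1// ler1n.
by have := gam_le _ inv0 inv1; rewrite -GammaE// lee_fin invrK.
Qed.

(** exp(1/n) is the a-th power of exp(1/p): each factor 1 + 1/n is absorbed by rescaling t by
    exp(1/p). *)
Let expRn : ((n%:R + 1) / n%:R <= expR n%:R^-1 :> R)%R.
Proof. by rewrite mulrDl mulfV ?gt_eqF// mul1r expR_ge1Dx. Qed.

Let F (t : R) : R := coord_cdf p k t.

Let W : R := (G / p)%R.

Let W0 : (0 < W)%R. Proof. exact: divr_gt0. Qed.

Let mw := measurable_weight p (a - 1).

Let w0 := weight_ge0 p (a - 1).

Let mpowR (c : R) : measurable_fun [set: R] (fun x : R => x `^ c)%R.
Proof. exact: measurable_fun_powR. Qed.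

Let mwle (t : R) := measurable_weight_le p k t.

Lemma coord_cdf_ge0 (t : R) : (0 <= F t)%R.
Proof.
rewrite -(pmulr_lge0 _ W0) -lee_fin -(coord_cdfE p k p0 t).
by apply: integral_ge0 => x _; rewrite lee_fin mulr_ge0.
Qed.

Lemma coord_cdf_le1 (t : R) : (F t <= 1)%R.
Proof.
rewrite -(ler_pM2r W0) mul1r -lee_fin -(coord_cdfE p k p0 t) -(total_weight p k p0).
apply: ge0_le_integral => //.
- by move=> x _; rewrite lee_fin mulr_ge0.
- by apply: measurable_funTS; apply/measurable_EFinP; exact: mwle.
- by apply: measurable_funTS; apply/measurable_EFinP; exact: mw.
- by move=> x _; rewrite lee_fin ler_piMr// lern1; case: (x <= t)%R.
Qed.

Lemma measurable_coord_cdf : measurable_fun [set: R] F.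
Proof.
have mF : measurable_fun [set: measurableTypeR R] (fun t => (F t * W)%:E).
  rewrite (_ : (fun t => _) = (fun t : measurableTypeR R =>
     \int[mu]_(x in `]0%R, +oo[) (weight p (a - 1) x * (x <= t)%R%:R)%:E)); last first.
    by apply/funext => t; rewrite -(coord_cdfE p k p0 t).
  apply: (measurable_fun_integral_on _ _ _ _ _ mu _
    (fun z : measurableTypeR R * measurableTypeR R => (weight p (a - 1) z.2 * (z.2 <= z.1)%R%:R)%:E)) => //.
    apply/measurable_EFinP; apply: measurable_funM; first exact: (measurableT_comp mw).
    by apply: measurable_fun_natr_bool; exact: measurable_fun_ler.
  by move=> z; rewrite lee_fin mulr_ge0.
rewrite (_ : F = (fun t => F t * W * W^-1)%R); last first.
  by apply/funext => t; rewrite mulfK// gt_eqF.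
apply: measurable_funM => //.
exact/measurable_EFinP.
Qed.

Let WE : (W = (G / n%:R) / a)%R.
Proof.
rewrite /W /a; field.
by rewrite !gt_eqF.
Qed.

(** Dropping exp(-x^p) <= 1 leaves t^a n / Gamma(1/n), at most t^a (1 + 1/n). *)
Lemma coord_cdf_le (t : R) : (0 <= t)%R -> (F t <= (t / expR (- p^-1)) `^ a)%R.
Proof.
move=> t0.
have H : (F t * W <= t `^ a / a)%R.
  rewrite -lee_fin -(coord_cdfE p k p0 t) -integral_powR1//.
  rewrite integral_itv_bndo_bndc; last by apply: measurable_funTS; exact/measurable_EFinP.
  have -> : \int[mu]_(x in `]0%R, t]) (x `^ (a - 1))%:E =
      \int[mu]_(x in `]0%R, +oo[) (x `^ (a - 1) * (x <= t)%R%:R)%:E.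
    rewrite [LHS]integral_mkcond [RHS]integral_mkcond; apply: eq_integral => x _.
    rewrite !patchE !mem_setE /= !in_itv/= andbT.
    by case: (0 < x)%R; case: (x <= t)%R; rewrite ?mulr1 ?mulr0.
  apply: ge0_le_integral => //.
  - by move=> x _; rewrite lee_fin mulr_ge0.
  - by apply: measurable_funTS; apply/measurable_EFinP; exact: mwle.
  - apply: measurable_funTS; apply/measurable_EFinP; apply: measurable_funM => //.
    by apply: measurable_fun_natr_bool; exact: measurable_fun_ler.
  - move=> x; rewrite /= in_itv/= andbT => x0; rewrite lee_fin ler_wpM2r//.
    by rewrite ler_piMr ?powR_ge0// expR_le1 oppr_le0 powR_ge0.
rewrite expRN invrK powRM ?expR_ge0// -expRM.
have -> : (p^-1 * a = n%:R^-1)%R by rewrite /a mulrA mulVf ?gt_eqF// mul1r.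
move: H; rewrite WE mulrA ler_pM2r ?invr_gt0// => H.
have Gn0 : (0 < G / n%:R)%R by exact: divr_gt0.
rewrite -(ler_pM2r Gn0); apply: (le_trans H).
rewrite -mulrA ler_peMr ?powR_ge0//.
apply: le_trans (ler_pM _ _ expRn le_Gamma_inv); last 2 first.
- by rewrite divr_ge0 ?addr_ge0// ltW.
- by rewrite divr_ge0 ?addr_ge0// ltW.
by rewrite mulrA divfK ?gt_eqF// mulfV// gt_eqF// addr_gt0.
Qed.

(** From exp(-x^p) >= 1 - x^p, and t^(a+p) <= t^a for t <= 1. One factor n / (n + 1) comes from 1/a
    - 1/(a+p), another from Gamma(1/n), hence the constant exp(2/p). *)
Lemma le_coord_cdf (t : R) : (0 <= t)%R -> (t <= 1)%R -> ((t / expR (2 / p)) `^ a <= F t)%R.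
Proof.
move=> t0 t1.
have ap0 : (0 < a + p)%R by exact: addr_gt0.
have H : (t `^ a / a <= F t * W + t `^ (a + p) / (a + p))%R.
  rewrite -lee_fin EFinD -(coord_cdfE p k p0 t) -!integral_powR1//.
  rewrite (@integral_itv_bndo_bndc _ _ _ (fun x => (x `^ (a - 1))%:E)); last first.
    by apply: measurable_funTS; exact/measurable_EFinP.
  rewrite (@integral_itv_bndo_bndc _ _ _ (fun x => (x `^ (a + p - 1))%:E)); last first.
    by apply: measurable_funTS; exact/measurable_EFinP.
  have -> : \int[mu]_(x in `]0%R, +oo[) (weight p (p / k.+1%:R - 1) x * (x <= t)%R%:R)%:E =
      \int[mu]_(x in `]0%R, t]) (weight p (a - 1) x)%:E.
    rewrite [LHS]integral_mkcond [RHS]integral_mkcond; apply: eq_integral => x _.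
    rewrite !patchE !mem_setE /= !in_itv/= andbT.
    by case: (0 < x)%R; case: (x <= t)%R; rewrite ?mulr1 ?mulr0.
  rewrite -ge0_integralD; last 5 first.
  - by [].
  - by move=> x _; rewrite lee_fin.
  - by apply: measurable_funTS; exact/measurable_EFinP.
  - by move=> x _; rewrite lee_fin powR_ge0.
  - by apply: measurable_funTS; exact/measurable_EFinP.
  apply: ge0_le_integral => //.
  - by move=> x _; rewrite lee_fin powR_ge0.
  - by apply: measurable_funTS; exact/measurable_EFinP.
  - by apply: measurable_funTS; apply: emeasurable_funD; exact/measurable_EFinP.
  - move=> x; rewrite /= in_itv/= => /andP[x0 _]; rewrite -EFinD lee_fin /weight.
    rewrite (_ : a + p - 1 = a - 1 + p)%R; last by ring.
    rewrite (@powRD _ x (a - 1)); last by rewrite (gt_eqF x0) implybT.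
    by rewrite -mulrDr ler_peMr ?powR_ge0// -lerBlDr expR_ge1Dx.
have tap : (t `^ (a + p) <= t `^ a)%R.
  have [->|tn0] := eqVneq t 0%R; first by rewrite !powR0// gt_eqF.
  by rewrite ger_powR ?t1 ?andbT ?lt0r ?tn0// lerDl ltW.
have H2 : (t `^ a * (n%:R / (n%:R + 1)) <= F t * (G / n%:R))%R.
  have : (t `^ a / a <= F t * W + t `^ a / (a + p))%R.
    by apply: (le_trans H); rewrite lerD2l ler_pM2r ?invr_gt0.
  rewrite -lerBlDr WE mulrA ler_pdivlMr//; apply: le_trans.
  rewrite le_eqVlt; apply/orP; left; apply/eqP; rewrite /a; field.
  by rewrite !gt_eqF ?addr_gt0 ?mulr_gt0.
have E : ((t / expR (2 / p)) `^ a = t `^ a / (expR n%:R^-1 * expR n%:R^-1))%R.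
  rewrite -expRN powRM ?expR_ge0// -expRM -expRD -expRN; congr (_ * expR _)%R.
  rewrite /a; field.
  by rewrite !gt_eqF.
rewrite E.
have q0 : (0 < (n%:R + 1) / n%:R :> R)%R by rewrite divr_gt0// addr_gt0.
apply: (@le_trans _ _ (t `^ a * (n%:R / (n%:R + 1)) / ((n%:R + 1) / n%:R))%R); last first.
  rewrite ler_pdivrMr//; apply: (le_trans H2).
  by rewrite ler_wpM2l// coord_cdf_ge0.
rewrite -mulrA ler_wpM2l ?powR_ge0// -[(n%:R / (n%:R + 1))%R]invf_div -invfM.
rewrite lef_pV2 ?posrE; [|by rewrite mulr_gt0 ?expR_gt0|by rewrite mulr_gt0].
by apply: ler_pM => //; exact: ltW.
Qed.

(** For x >= 1, x^(a-1) <= x^(p-1) since a <= p, and p x^(p-1) exp(-x^p) integrates exactly by u =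
    x^p. *)
Lemma coord_cdf_tail (t : R) : (1 <= t)%R -> (1 - F t <= expR (- t `^ p) / G)%R.
Proof.
move=> t1; have t0 : (0 < t)%R by rewrite (lt_le_trans ltr01).
have mwgt : measurable_fun [set: R] (fun x => weight p (a - 1) x * (t < x)%R%:R)%R.
  by apply: measurable_funM => //; apply: measurable_fun_natr_bool; exact: measurable_fun_ltr.
pose f (x : R) : R := (expR (- x) * (t `^ p <= x)%R%:R)%R.
have mf : measurable_fun [set: R] f.
  apply: measurable_funM; last by apply: measurable_fun_natr_bool; exact: measurable_fun_ler.
  by apply: (measurableT_comp (@measurable_expR R)).
have f0 x : (0 <= f x)%R by rewrite mulr_ge0 ?expR_ge0.
have H1 : W%:E = (F t * W)%:E + \int[mu]_(x in `]0%R, +oo[) (weight p (a - 1) x * (t < x)%R%:R)%:E.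
  rewrite -[LHS](total_weight p k p0) -(coord_cdfE p k p0 t) -ge0_integralD; last 5 first.
  - by [].
  - by move=> x _; rewrite lee_fin mulr_ge0.
  - by apply: measurable_funTS; apply/measurable_EFinP; exact: mwle.
  - by move=> x _; rewrite lee_fin mulr_ge0.
  - by apply: measurable_funTS; exact/measurable_EFinP.
  apply: eq_integral => x _; rewrite -EFinD -mulrDr; congr EFin.
  by case: (ltP t x) => _; rewrite ?add0r ?addr0 mulr1.
have H2 : \int[mu]_(x in `]0%R, +oo[) ((p * x `^ (p - 1))%:E * (f (x `^ p)%R)%:E) = (expR (- t `^ p))%:E.
  rewrite (integral_powR_subst p (EFin \o f))//; last by exact/measurable_EFinP.
  rewrite -(integral_expRN_tail (t `^ p)%R) ?powR_gt0//.
  rewrite [LHS]integral_mkcond [RHS]integral_mkcond; apply: eq_integral => x _.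
  rewrite !patchE !mem_setE /= !in_itv/= !andbT /f.
  have [tx|tx] := leP (t `^ p)%R x; last by rewrite mulr0 if_same.
  by rewrite (lt_le_trans _ tx) ?powR_gt0// mulr1.
have H3 : \int[mu]_(x in `]0%R, +oo[) (p%:E * (weight p (a - 1) x * (t < x)%R%:R)%:E) <= (expR (- t `^ p))%:E.
  rewrite -H2; apply: ge0_le_integral => //.
  - by move=> x _; rewrite -EFinM lee_fin !mulr_ge0 ?powR_ge0 ?expR_ge0 ?(ltW p0).
  - by apply: measurable_funTS; apply: emeasurable_funM => //; exact/measurable_EFinP.
  - apply: measurable_funTS; apply: emeasurable_funM; apply/measurable_EFinP.
      exact: measurable_funM.
    exact: (measurableT_comp mf).
  - move=> x; rewrite /= in_itv/= andbT => x0.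
    rewrite -!EFinM lee_fin -!mulrA ler_wpM2l ?(ltW p0)//.
    have [tx|tx] := ltP t x; last by rewrite !mulr0 mulr_ge0 ?powR_ge0.
    rewrite mulr1 /weight /f.
    have -> : (t `^ p <= x `^ p)%R by rewrite ge0_ler_powR ?nnegrE ?(ltW p0) ?(ltW t0) ?(ltW x0) ?(ltW tx).
    rewrite mulr1 ler_wpM2r ?expR_ge0// ler_powR ?lerD2r//.
      by rewrite (le_trans t1)// ltW.
    by rewrite /a ler_pdivrMr// ler_peMr ?(ltW p0)// ler1n.
move: H3; rewrite ge0_integralZl; last 4 first.
- by [].
- by apply: measurable_funTS; exact/measurable_EFinP.
- by move=> x _; rewrite lee_fin mulr_ge0.
- by rewrite lee_fin ltW.
move: H1; case: (\int[mu]_(x in _) _) => [r| |]//; rewrite -EFinD => -[H1].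
rewrite -EFinM lee_fin => H3.
rewrite ler_pdivlMr//; apply: le_trans H3.
rewrite (_ : r = W - F t * W)%R; last by rewrite {1}H1 addrAC subrr add0r.
rewrite /W le_eqVlt; apply/orP; left; apply/eqP; field.
by rewrite gt_eqF.
Qed.

End estimates.

(** * Bounds on the mean order statistic *)

Section tail_prob_bounds.
Context {R : realType}.
Local Notation mu := (@lebesgue_measure R).
Local Open Scope ereal_scope.
Variables (p : R) (k : nat).
Hypothesis p0 : (0 < p)%R.
Let n := k.+1.

Let n0 : (0 < n%:R :> R)%R. Proof. by rewrite ltr0n. Qed.
Let np0 : (0 < n%:R / p)%R. Proof. exact: divr_gt0. Qed.
Let npV : ((n%:R / p)^-1 = p / n%:R)%R. Proof. by rewrite invf_div. Qed.

Let mT m : measurable_fun [set: R] (fun t => tail_prob (coord_cdf p k t) n m).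
Proof. by apply: measurable_tail_prob; exact: measurable_coord_cdf. Qed.

Let T0 m t : (0 <= tail_prob (coord_cdf p k t) n m)%R.
Proof. by apply: tail_prob_ge0; rewrite coord_cdf_ge0// coord_cdf_le1. Qed.

(** Only levels t < exp(-1/p) are kept: there the upper bound on the distribution function is at
    most 1, and the integral of the resulting tail is an exact order moment. *)
Lemma le_integral_tail_prob m :
  (expR (- p^-1) * order_moment (n%:R / p) n m)%:E <=
  \int[mu]_(t in `]0%R, +oo[) (tail_prob (coord_cdf p k t) n m)%:E.
Proof.
set c := expR (- p^-1); have c0 : (0 < c)%R by exact: expR_gt0.
have small t : (0 < t)%R -> (t < c)%R -> ((t / c) `^ (p / n%:R) <= 1)%R.
  move=> t0 tc; rewrite -[leRHS](powRr0 (t / c)%R) ger_powR//.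
    by rewrite divr_gt0//= ler_pdivrMr// mul1r ltW.
  exact: divr_ge0 (ltW p0) (ltW n0).
rewrite -integral_tail_prob_powR//.
apply: (@le_trans _ _ (\int[mu]_(t in `]0%R, c[) (tail_prob (coord_cdf p k t) n m)%:E)).
  apply: ge0_le_integral => //.
  - move=> t t01; have /andP[t0 tc] : (0 < t < c)%R by move: t01; rewrite /= in_itv.
    by rewrite lee_fin tail_prob_ge0// powR_ge0 npV small.
  - apply: measurable_funTS; apply/measurable_EFinP; apply: measurable_tail_prob.
    by apply: measurable_fun_powR; exact: mulrr_measurable.
  - by apply: measurable_funTS; apply/measurable_EFinP; exact: mT.
  - move=> t t01; have /andP[t0 tc] : (0 < t < c)%R by move: t01; rewrite /= in_itv.
    rewrite lee_fin npV; apply: le_tail_prob; last exact: small.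
      exact: coord_cdf_ge0.
    by apply: coord_cdf_le => //; exact: ltW.
apply: ge0_subset_integral => //.
- by apply: measurable_funTS; apply/measurable_EFinP; exact: mT.
- by move=> t _; rewrite lee_fin.
- by move=> t /=; rewrite !in_itv/= andbT => /andP[].
Qed.

(** Below 1 the lower bound on the distribution function applies, and the range is then enlarged to
    (0, exp(2/p)) to get an exact moment. Above 1, exp(-m t^p) <= exp(-m) exp(1 - t^p) isolates the
    factor e^(-m); the integral of exp(1 - t^p) is e Gamma(1/p) / p. *)
Lemma integral_tail_prob_le m : (0 < m)%N ->
  \int[mu]_(t in `]0%R, +oo[) (tail_prob (coord_cdf p k t) n m)%:E <=
  (expR (2 / p) * order_moment (n%:R / p) n m +
   'C(n, m)%:R * (expR (- 1) / Gamma n%:R^-1) ^+ m * (expR 1 * (Gamma p^-1 / p)))%:E.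
Proof.
move=> m0; set c := expR (2 / p); have c0 : (0 < c)%R by exact: expR_gt0.
have c1 : (1 <= c)%R by rewrite -expR0 ler_expR divr_ge0// ltW.
have G0 : (0 < Gamma n%:R^-1 :> R)%R by apply: Gamma_gt0; rewrite invr_gt0.
have small t : (0 < t)%R -> (t < c)%R -> (0 <= (t / c) `^ (p / n%:R) <= 1)%R.
  move=> t0 tc; rewrite powR_ge0/= -[leRHS](powRr0 (t / c)%R) ger_powR//.
    by rewrite divr_gt0//= ler_pdivrMr// mul1r ltW.
  exact: divr_ge0 (ltW p0) (ltW n0).
have mTc : measurable_fun [set: R] (fun t => tail_prob ((t / c) `^ (n%:R / p)^-1) n m)%R.
  by apply: measurable_tail_prob; apply: measurable_fun_powR; exact: mulrr_measurable.
pose E : \bar R := \int[mu]_(t in `]0%R, +oo[)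
  (('C(n, m)%:R * (expR (- 1) / Gamma n%:R^-1) ^+ m * expR 1) * expR (- t `^ p))%:E.
have EE : E = ('C(n, m)%:R * (expR (- 1) / Gamma n%:R^-1) ^+ m * (expR 1 * (Gamma p^-1 / p)))%:E.
  rewrite /E mulrA EFinM -integral_weight ?invr_gt0// -ge0_integralZl; last 4 first.
  - by [].
  - by apply: measurable_funTS; apply/measurable_EFinP; exact: measurable_weight.
  - by move=> x _; rewrite lee_fin weight_ge0.
  - by rewrite lee_fin !mulr_ge0 ?expR_ge0// exprn_ge0// divr_ge0 ?expR_ge0// ltW.
  apply: eq_integral => x _; rewrite -EFinM; congr EFin.
  by rewrite /weight mulfV ?gt_eqF// subrr powRr0 mul1r.
have mE : measurable_fun [set: R] (fun t =>
   ('C(n, m)%:R * (expR (- 1) / Gamma n%:R^-1) ^+ m * expR 1) * expR (- t `^ p))%R.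
  apply: measurable_funM => //; apply: (measurableT_comp (@measurable_expR R)).
  by apply: measurableT_comp => //; exact: measurable_fun_powR.
have E0 t : (0 <= ('C(n, m)%:R * (expR (- 1) / Gamma n%:R^-1) ^+ m * expR 1) * expR (- t `^ p))%R.
  by rewrite !mulr_ge0 ?expR_ge0// exprn_ge0// divr_ge0 ?expR_ge0// ltW.
have -> : \int[mu]_(t in `]0%R, +oo[) (tail_prob (coord_cdf p k t) n m)%:E =
    \int[mu]_(t in `]0%R, 1%R[) (tail_prob (coord_cdf p k t) n m)%:E +
    \int[mu]_(t in `[1%R, +oo[) (tail_prob (coord_cdf p k t) n m)%:E.
  by apply: integral_split_at1.
rewrite EFinD -EE -integral_tail_prob_powR//; apply: leeD.
  apply: (@le_trans _ _ (\int[mu]_(t in `]0%R, 1%R[) (tail_prob ((t / c) `^ (n%:R / p)^-1) n m)%:E)).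
    apply: ge0_le_integral => //.
    - by move=> t _; rewrite lee_fin.
    - by apply: measurable_funTS; apply/measurable_EFinP; exact: mT.
    - by apply: measurable_funTS; exact/measurable_EFinP.
    - move=> t t01; have /andP[t0 t1] : (0 < t < 1)%R by move: t01; rewrite /= in_itv.
      rewrite lee_fin npV; apply: le_tail_prob; first exact: powR_ge0.
        by apply: le_coord_cdf => //; exact: ltW.
      exact: coord_cdf_le1.
  apply: ge0_subset_integral => //.
  - by apply: measurable_funTS; exact/measurable_EFinP.
  - move=> t t01; have /andP[t0 tc] : (0 < t < c)%R by move: t01; rewrite /= in_itv.
    by rewrite lee_fin tail_prob_ge0// npV small.
  - by move=> t /=; rewrite !in_itv/= => /andP[-> /lt_le_trans ->].
apply: (@le_trans _ _ (\int[mu]_(t in `[1%R, +oo[)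
  (('C(n, m)%:R * (expR (- 1) / Gamma n%:R^-1) ^+ m * expR 1) * expR (- t `^ p))%:E)); last first.
  apply: ge0_subset_integral => //.
  - by apply: measurable_funTS; exact/measurable_EFinP.
  - by move=> t _; rewrite lee_fin.
  - by move=> t /=; rewrite !in_itv/= !andbT; exact: lt_le_trans.
apply: ge0_le_integral => //.
- by move=> t _; rewrite lee_fin.
- by apply: measurable_funTS; apply/measurable_EFinP; exact: mT.
- by apply: measurable_funTS; exact/measurable_EFinP.
- move=> t t1'; have t1 : (1 <= t)%R by move: t1'; rewrite /= in_itv/= andbT.
  rewrite lee_fin.
  have F01 : (0 <= coord_cdf p k t <= 1)%R by rewrite coord_cdf_ge0// coord_cdf_le1.
  apply: (le_trans (tail_prob_le_bin _ _ _ F01)).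
  rewrite -!mulrA ler_wpM2l//.
  apply: (@le_trans _ _ ((expR (- t `^ p) / Gamma n%:R^-1) ^+ m)%R).
    rewrite lerXn2r ?nnegrE ?subr_ge0 ?coord_cdf_le1//.
      by rewrite divr_ge0 ?expR_ge0// ltW.
    exact: coord_cdf_tail.
  rewrite !expr_div_n mulrAC ler_pM2r ?invr_gt0 ?exprn_gt0//.
  rewrite -!expRM_natl -!expRD ler_expR.
  have tp : (1 <= t `^ p)%R by rewrite -[leLHS](powRr0 t) ler_powR// ltW.
  have m1 : (1 <= m%:R :> R)%R by rewrite ler1n.
  (* The gap between the exponents is (m - 1)(t^p - 1), nonnegative as m >= 1 and t >= 1. *)
  rewrite -subr_ge0.
  have -> : (m%:R * -1 + (1 + - t `^ p) - m%:R * - t `^ p = (m%:R - 1) * (t `^ p - 1))%R by ring.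
  by rewrite mulr_ge0// subr_ge0.
Qed.

End tail_prob_bounds.

(** * Gamma quotients and their limits *)

Section constants.
Context {R : realType}.

Lemma Gamma_ratio (z : R) n m : 0 <= z -> (m <= n)%N ->
  Gamma (z + n%:R + 1) = \prod_(i < m) (z + n%:R - i%:R) * Gamma (z + n%:R - m%:R + 1).
Proof.
move=> z0; elim: m => [|m IH] mn; first by rewrite big_ord0 mul1r subr0.
have zm : 0 < z + n%:R - m%:R.
  by rewrite -addrA ltr_wpDl// subr_gt0 ltr_nat.
have -> : z + n%:R - m.+1%:R + 1 = z + n%:R - m%:R by rewrite -natr1; ring.
by rewrite (IH (ltnW mn)) (GammaS _ zm) big_ord_recr -mulrA.
Qed.

Lemma prod_natrB n m : (m <= n)%N -> \prod_(i < m) (n%:R - i%:R : R) = (n ^_ m)%:R.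
Proof.
elim: m => [|m IH] mn; first by rewrite big_ord0 ffactn0.
by rewrite big_ord_recr/= IH ?(ltnW mn)// ffactnSr natrM natrB// ltnW.
Qed.

Lemma Gamma_natr_ratio n m : (m <= n)%N ->
  Gamma (n%:R + 1) / Gamma (n%:R - m%:R + 1) = (n ^_ m)%:R :> R.
Proof.
move=> mn; have := Gamma_ratio 0 n m (lexx 0) mn; rewrite add0r => ->.
rewrite prod_natrB// mulfK// gt_eqF//; apply: Gamma_gt0.
by rewrite -natrB// ltr_wpDl.
Qed.

Lemma order_moment_Gamma (z : R) n m : 0 <= z -> (m <= n)%N ->
  order_moment z n m = Gamma (n%:R + 1) / Gamma (n%:R - m%:R + 1) *
    (Gamma (z + n%:R - m%:R + 1) / Gamma (z + n%:R + 1)).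
Proof.
move=> z0 mn; rewrite /order_moment prodf_div prod_natrB// Gamma_natr_ratio//.
congr (_ * _); rewrite (Gamma_ratio z n m z0 mn) invfM mulrCA mulfV ?mulr1//.
rewrite gt_eqF//; apply: Gamma_gt0.
by rewrite -addrA -addrA ltr_wpDl// addrA -natrB// ltr_wpDl.
Qed.

Lemma bin_ffact_fact n m : 'C(n, m)%:R = (n ^_ m)%:R * (m`!%:R)^-1 :> R.
Proof.
by rewrite -bin_ffact natrM mulfK// pnatr_eq0 -lt0n fact_gt0.
Qed.

Lemma order_moment_ge0 (z : R) n m : 0 <= z -> (m <= n)%N -> 0 <= order_moment z n m.
Proof.
move=> z0 mn; apply: prodr_ge0 => i _; have im : (i <= n)%N.
  by rewrite (leq_trans _ mn)// ltnW.
have d0 : 0 <= n%:R - i%:R :> R by rewrite subr_ge0 ler_nat.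
by rewrite divr_ge0// -addrA addr_ge0.
Qed.

(** Factor by factor: (n - i) / (n/q + n - i) is largest at i = 0, where it equals 1 / (1/q + 1). *)
Lemma order_moment_le (q : R) k m : 0 < q -> (m <= k.+1)%N ->
  order_moment (k.+1%:R / q) k.+1 m <= ((q^-1 + 1) ^+ m)^-1.
Proof.
move=> q0 mk; have n0 : 0 < k.+1%:R :> R by rewrite ltr0n.
have qi : 0 < q^-1 by rewrite invr_gt0.
have -> : ((q^-1 + 1) ^+ m)^-1 = \prod_(i < m) (q^-1 + 1)^-1.
  by rewrite prodr_const card_ord exprVn.
apply: ler_prod => i _.
have im : (i < k.+1)%N by rewrite (leq_trans _ mk).
have i1 : 0 < k.+1%:R - i%:R :> R by rewrite subr_gt0 ltr_nat.
have d0 : 0 < k.+1%:R / q + k.+1%:R - i%:R by rewrite -addrA addr_gt0// divr_gt0.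
rewrite divr_ge0 ?(ltW i1) ?(ltW d0)//=.
rewrite ler_pdivrMr// ler_pdivlMl ?addr_gt0//.
rewrite -subr_ge0.
have -> : k.+1%:R / q + k.+1%:R - i%:R - (q^-1 + 1) * (k.+1%:R - i%:R) = q^-1 * i%:R by ring.
by rewrite mulr_ge0// ltW.
Qed.

(** The number of factors is fixed; dividing numerator and denominator of each by n = k + 1 leaves
    only terms i / n tending to 0. *)
Lemma cvg_order_moment (q : R) m : 0 < q ->
  order_moment (k.+1%:R / q) k.+1 m @[k --> \oo] --> ((q^-1 + 1) ^+ m)^-1.
Proof.
move=> q0; have qi : 0 < q^-1 by rewrite invr_gt0.
have q1 : 0 < q^-1 + 1 by rewrite addr_gt0.
rewrite -exprVn; elim: m => [|m IH].
  rewrite expr0; under eq_fun do rewrite /order_moment big_ord0; exact: cvg_cst.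
rewrite exprSr; under eq_fun do rewrite /order_moment big_ord_recr.
apply: cvgM; first exact: IH.
pose h (k : nat) : R := m%:R * harmonic k.
have ch : h @ \oo --> (0 : R).
  rewrite -[X in _ --> X](mulr0 (m%:R : R)); apply: cvgM; first exact: cvg_cst.
  exact: cvg_harmonic.
rewrite (_ : (fun k : nat => _) = (fun k => (1 - h k) / (q^-1 + 1 - h k))).
  have c1 : (1 - h k) @[k --> \oo] --> (1 - 0 : R) by apply: cvgB ch; exact: cvg_cst.
  have c2 : (q^-1 + 1 - h k) @[k --> \oo] --> q^-1 + 1 - 0.
    by apply: cvgB ch; exact: cvg_cst.
  have q10 : q^-1 + 1 - 0 != 0 by rewrite subr0 gt_eqF.
  by have := cvgM c1 (cvgV q10 c2); rewrite !subr0 mul1r; exact.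
apply/funext => k; have n0 : k.+1%:R != 0 :> R by rewrite pnatr_eq0.
rewrite /h /harmonic.
have -> : k.+1%:R / q + k.+1%:R - m%:R = k.+1%:R * (q^-1 + 1 - m%:R / k.+1%:R).
  rewrite mulrBr mulrCA mulfV// mulr1; ring.
have -> : k.+1%:R - m%:R = k.+1%:R * (1 - m%:R / k.+1%:R) :> R.
  by rewrite mulrBr mulrCA mulfV// !mulr1.
by rewrite invfM mulrACA mulfV// mul1r.
Qed.

End constants.

Section limits.
Context {R : realType}.
Local Open Scope ereal_scope.

Lemma limn_esup_le (s : (\bar R)^nat) (l : \bar R) (N : nat) :
  (forall n, (N <= n)%N -> s n <= l) -> limn_esup s <= l.
Proof.
move=> H; rewrite limn_esup_lim; apply: lime_le; first exact: is_cvg_esups.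
near=> n; apply: ge_ereal_sup => _ [j /= nj <-]; apply: H.
by apply: leq_trans nj; near: n; exists N.
Unshelve. all: by end_near. Qed.

Lemma limn_einf_ge (s : (\bar R)^nat) (l : \bar R) (N : nat) :
  (forall n, (N <= n)%N -> l <= s n) -> l <= limn_einf s.
Proof.
move=> H; rewrite limn_einf_lim; apply: lime_ge; first exact: is_cvg_einfs.
near=> n; apply: le_ereal_inf_tmp => _ [j /= nj <-]; apply: H.
by apply: leq_trans nj; near: n; exists N.
Unshelve. all: by end_near. Qed.

End limits.

Lemma bin_le_expn n m : ('C(n, m) * m`! <= n ^ m)%N.
Proof.
rewrite bin_ffact; elim: m => [|m IH]; first by rewrite ffactn0.
by rewrite ffactnSr expnSr leq_mul// leq_subr.
Qed.

(** Gamma(1/n) >= n^2 / (n + 1) >= n / 2 and e >= 2 give n / (e Gamma(1/n)) <= 1, so the union-bound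
    term is at most 1/m!; and q^m / m! is a single term of the series of e^q. *)
Lemma bin_Gamma_le (R : realType) (q : R) k m : 0 < q -> (0 < m)%N ->
  'C(k.+1, m)%:R * (expR (- 1) / Gamma k.+1%:R^-1) ^+ m <= expR q / q ^+ m.
Proof.
move=> q0 m0; have n0 : 0 < k.+1%:R :> R by rewrite ltr0n.
have G0 : 0 < Gamma k.+1%:R^-1 :> R by apply: Gamma_gt0; rewrite invr_gt0.
have f0 : 0 < m`!%:R :> R by rewrite ltr0n fact_gt0.
have small : k.+1%:R * (expR (- 1) / Gamma k.+1%:R^-1) <= 1 :> R.
  rewrite mulrA ler_pdivrMr// mul1r expRN ler_pdivrMr ?expR_gt0//.
  have := @le_Gamma_inv R k; rewrite ler_pdivlMr// => H.
  have e2 : 2 <= expR 1 :> R by apply: le_trans (expR_ge1Dx 1); rewrite -natr1.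
  apply: (@le_trans _ _ (Gamma k.+1%:R^-1 * 2)); last by rewrite ler_wpM2l// ltW.
  rewrite -ler_pdivrMr//; apply: le_trans H.
  rewrite mulrC ler_pM2r// ler_pdivlMr ?addr_gt0// ler_pdivrMl//.
  by rewrite mulr_natl mulr2n lerD2l ler1n.
have bin : 'C(k.+1, m)%:R <= k.+1%:R ^+ m / m`!%:R :> R.
  by rewrite ler_pdivlMr// -natrM -natrX ler_nat bin_le_expn.
apply: (@le_trans _ _ (m`!%:R^-1)).
  apply: (@le_trans _ _ (k.+1%:R ^+ m / m`!%:R * (expR (- 1) / Gamma k.+1%:R^-1) ^+ m)).
    by rewrite ler_wpM2r// exprn_ge0// divr_ge0 ?expR_ge0// ltW.
  rewrite mulrAC -exprMn ler_piMl ?invr_ge0 ?(ltW f0)// exprn_ile1//.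
  by rewrite mulr_ge0// divr_ge0 ?expR_ge0// ltW.
rewrite ler_pdivlMr ?exprn_gt0// mulrC.
case: m m0 {f0 bin} => // m _.
by apply: le_trans (expR_ge1Dxn m (ltW q0)); rewrite lerDr.
Qed.

Theorem theorem16 (R : realType) (p : R) (hp : 0 < p) :
  (exists C1 C2 : R, [/\ 0 < C1, 0 < C2 &
    forall n m : nat, (2 <= n)%N -> (1 <= m <= n)%N ->
    ((C1 * (Gamma (n%:R + 1) / Gamma (n%:R - m%:R + 1))
         * (Gamma (n%:R / p + n%:R - m%:R + 1) / Gamma (n%:R / p + n%:R + 1)))%:E
      <= avg_best_approx p +oo (m - 1) (theta p (p / n%:R - 1) n))%E /\
    (avg_best_approx p +oo (m - 1) (theta p (p / n%:R - 1) n) <=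
     (C2 * (Gamma (n%:R + 1) / Gamma (n%:R - m%:R + 1))
         * (Gamma (n%:R / p + n%:R - m%:R + 1) / Gamma (n%:R / p + n%:R + 1)
            + (m`!%:R)^-1 * (expR (- 1) / Gamma (n%:R^-1)) ^+ m))%:E)%E])
  /\
  (exists C1 C2 : R, [/\ 0 < C1, 0 < C2 &
    forall m : nat, (1 <= m)%N ->
    let s := fun n : nat =>
      avg_best_approx p +oo (m - 1) (theta p (p / n%:R - 1) n) in
    [/\ ((C1 / (p^-1 + 1) ^+ m)%:E <= limn_einf s)%E,
        (limn_einf s <= limn_esup s)%E &
        (limn_esup s <= (C2 / (p^-1 + 1) ^+ m)%:E)%E]]).
Proof.
have pi0 : 0 < p^-1 by rewrite invr_gt0.
have q0 : 0 < p^-1 + 1 by rewrite addr_gt0.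
pose c0 : R := Gamma 1 / Gamma (p^-1 + 1).
have c00 : 0 < c0 by apply: divr_gt0; exact: Gamma_gt0.
pose D : R := expR 1 * (Gamma p^-1 / p).
have D0 : 0 < D by apply: mulr_gt0; [exact: expR_gt0|exact: Gamma_div_gt0].
pose P n m : R := order_moment (n%:R / p) n m.
pose Q n m : R := 'C(n, m)%:R * (expR (- 1) / Gamma n%:R^-1) ^+ m.
have P0 n m : (m <= n)%N -> 0 <= P n m.
  by move=> mn; apply: order_moment_ge0 => //; exact: divr_ge0 (ler0n _ _) (ltW hp).
have G0 n : 0 < Gamma n.+1%:R^-1 :> R by apply: Gamma_gt0; rewrite invr_gt0.
have Q0 n m : 0 <= Q n.+1 m.
  exact: mulr_ge0 (ler0n _ _) (exprn_ge0 _ (divr_ge0 (expR_ge0 _) (ltW (G0 n)))).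
pose C1 : R := c0 * expR (- p^-1).
(* The sum of the constants of the two terms serves as a common factor for both. *)
pose C2 : R := c0 * (expR (2 / p) + D).
have C10 : 0 < C1 by apply: mulr_gt0 => //; exact: expR_gt0.
have C20 : 0 < C2 by apply: mulr_gt0 => //; apply: addr_gt0 => //; exact: expR_gt0.
have main n m : (0 < n)%N -> (1 <= m <= n)%N ->
    ((C1 * P n m)%:E <= avg_best_approx p +oo (m - 1) (theta p (p / n%:R - 1) n))%E /\
    (avg_best_approx p +oo (m - 1) (theta p (p / n%:R - 1) n) <= (C2 * (P n m + Q n m))%:E)%E.
  (* The m of the claim becomes [m.+1]: the error with m terms exceeds t when at least m + 1
     coordinates do, the index in [tail_prob]. *)
  case: n => // k _; case: m => // m /andP[_ mk]; rewrite subn1 [m.+1.-1]/=.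
  rewrite avg_best_approxE// -/c0; split.
    rewrite -mulrA EFinM lee_pmul2l ?lte_fin//.
    exact: le_integral_tail_prob.
  have -> : C2 * (P k.+1 m.+1 + Q k.+1 m.+1) =
      c0 * ((expR (2 / p) + D) * (P k.+1 m.+1 + Q k.+1 m.+1)) by rewrite mulrA.
  rewrite (EFinM c0) lee_pmul2l ?lte_fin//.
  apply: (le_trans (integral_tail_prob_le p k hp m.+1 isT)); rewrite lee_fin.
  rewrite -/(P _ _) -/(Q _ _) -/D -subr_ge0.
  have -> : (expR (2 / p) + D) * (P k.+1 m.+1 + Q k.+1 m.+1) -
    (expR (2 / p) * P k.+1 m.+1 + Q k.+1 m.+1 * D) =
    expR (2 / p) * Q k.+1 m.+1 + D * P k.+1 m.+1 by ring.
  exact: addr_ge0 (mulr_ge0 (expR_ge0 _) (Q0 _ _)) (mulr_ge0 (ltW D0) (P0 _ _ mk)).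
split.
  exists C1, C2; split => // n m n2 /andP[m1 mn].
  have n0 : (0 < n)%N by rewrite (leq_trans _ n2).
  have [H1 H2] := main n m n0 (introT andP (conj m1 mn)).
  have np0 : 0 <= n%:R / p by exact: divr_ge0 (ler0n _ _) (ltW hp).
  split.
    by rewrite -mulrA -order_moment_Gamma.
  (* The outer Gamma quotient is the falling factorial, which with 1/m! is the binomial coefficient
     of the union bound. *)
  by rewrite -mulrA mulrDr -order_moment_Gamma// mulrA Gamma_natr_ratio// -bin_ffact_fact.
(* The half leaves room for the order moment to be merely close to its limit; 1 and exp(1/p + 1)
   come from the two terms of the upper bound. *)
exists (C1 / 2), (C2 * (1 + expR (p^-1 + 1))); split.
- by rewrite divr_gt0.
- by rewrite mulr_gt0// addr_gt0// expR_gt0.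
move=> m m1 s; split.
- have q2 : 0 < ((p^-1 + 1) ^+ m)^-1 / 2 by rewrite divr_gt0// invr_gt0 exprn_gt0.
  have /cvgrPdist_le/(_ _ q2)[N _ HN] := cvg_order_moment p m hp.
  (* [N.+1] because the limit is indexed by k with n = k + 1, and m because the bounds require m <=
     n. *)
  apply: (limn_einf_ge _ _ (maxn N.+1 m)) => n.
  rewrite geq_max => /andP[Nn mn]; case: n Nn mn => // k Nk mk.
  have [H _] := main k.+1 m isT (introT andP (conj m1 mk)).
  apply: le_trans H; rewrite lee_fin -mulrA ler_wpM2l ?(ltW C10)//.
  have := HN k Nk; rewrite -/(P _ _) => /ler_normlP[_].
  rewrite lerBlDl -lerBlDr; apply: le_trans.
  by rewrite le_eqVlt; apply/orP; left; apply/eqP; field; rewrite expf_neq0// gt_eqF.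
- exact: limn_einf_sup.
- apply: (limn_esup_le _ _ m) => n mn.
  have n0 : (0 < n)%N by exact: leq_trans mn.
  have [_ H] := main n m n0 (introT andP (conj m1 mn)).
  apply: (le_trans H); rewrite lee_fin -mulrA ler_wpM2l ?(ltW C20)//.
  case: n mn n0 {H} => // k mk _.
  rewrite mulrDl mul1r; apply: lerD; first exact: order_moment_le.
  exact: bin_Gamma_le.
Qed.
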